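(* In type $B_n$, let $S$ be the spin module, i.e. the irreducible module of highest weight $\varpi_n=\frac12(\varepsilon_1+\cdots+\varepsilon_n)$. Then every tensor power $S^{\otimes r}$ of $S$ is a saturated module; that is, the set of highest weights of the composition factors of $S^{\otimes r}$ equals the set of all dominant weights of $S^{\otimes r}$.
   Context: Root datum of type $B_n$ (for the simply connected group $\mathsf{Spin}(2n+1)$, with Lie algebra $\mathfrak{so}_{2n+1}$, in characteristic $0$): $X=\mathbb{Z}^n\cup((\tfrac12,\dots,\tfrac12)+\mathbb{Z}^n)\subset\mathbb{Q}^n$ with standard basis vectors $\varepsilon_1,\dots,\varepsilon_n$ of $\mathbb{Q}^n$; simple roots $\alpha_i=\varepsilon_i-\varepsilon_{i+1}$ ($1\le i\le n-1$), $\alpha_n=\varepsilon_n$; with $H_1,\dots,H_n$ the basis dual to $\varepsilon_1,\dots,\varepsilon_n$, the simple coroots are $h_i=H_i-H_{i+1}$ ($1\le i\le n-1$), $h_n=2H_n$. The fundamental weights are $\varpi_i=\varepsilon_1+\cdots+\varepsilon_i$ ($1\le i\le n-1$) and $\varpi_n=\frac12(\varepsilon_1+\cdots+\varepsilon_n)$. Dominant weights are the $\lambda\in X$ with $\langle h_i,\lambda\rangle\ge0$ for all $i$. A finite-dimensional module $M$ with a weight space decomposition is called saturated if the set of highest weights of its composition factors coincides with the set $\Pi^+(M)$ of dominant weights of $M$ (dominant $\lambda$ with $M_\lambda\neq0$). *)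

(* Defs.v *)
From HB Require Import structures.
From mathcomp Require Import all_boot all_order all_algebra.
From mathcomp Require Import ring mxtens.

Set Implicit Arguments.
Unset Strict Implicit.
Unset Printing Implicit Defensive.

Import Order.TTheory GRing.Theory Num.Theory.
Local Open Scope ring_scope.

(* Root datum of type B_n.  Weights are row vectors in rat^n and indices start
   at 0: eps k stands for \varepsilon_(k+1).  The coweight basis H_1, ..., H_n
   dual to the \varepsilon_i is used to write coroots as row vectors too. *)
Section RootDatum.
Variable n : nat.
Implicit Types (la : 'rV[rat]_n) (i j : 'I_n).

Definition eps (k : nat) : 'rV[rat]_n := \row_(j < n) (j == k :> nat)%:R.

Definition simple_root i : 'rV[rat]_n :=
  if i.+1 == n then eps i else eps i - eps i.+1.

Definition simple_coroot i : 'rV[rat]_n :=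
  if i.+1 == n then 2%:R *: eps i else eps i - eps i.+1.

Definition pairing (h la : 'rV[rat]_n) : rat := \sum_j h 0 j * la 0 j.

Definition in_weight_lattice la : Prop :=
  (forall i, la 0 i \is a Num.int) \/
  (forall i, la 0 i - 2%:R^-1 \is a Num.int).

Definition dominant la : Prop :=
  in_weight_lattice la /\ forall i, 0 <= pairing (simple_coroot i) la.

Definition spin_weight : 'rV[rat]_n := 2%:R^-1 *: \sum_(i < n) eps i.

End RootDatum.

(* The split form of so_(2n+1): matrices that are skew for the symmetric
   bilinear form with Gram matrix so_form.  In coordinates
   (x_1..x_n, y_1..y_n, z) the quadratic form is 2 \sum_i x_i y_i + z ^ 2, and
   the diagonal matrices diag(t, -t, 0) are a split Cartan subalgebra. *)
Section LieAlgebra.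
Variables (F : fieldType) (n : nat).

Definition so_form : 'M[F]_(n + n + 1) :=
  block_mx (block_mx 0 1%:M 1%:M 0) 0 0 1%:M.

Definition so : {pred 'M[F]_(n + n + 1)} :=
  [pred A | A^T *m so_form + so_form *m A == 0].

Definition lie_bracket d (A B : 'M[F]_d) : 'M[F]_d := A *m B - B *m A.

Definition cartan (i : 'I_n) : 'M[F]_(n + n + 1) :=
  block_mx (block_mx (delta_mx i i) 0 0 (- delta_mx i i)) 0 0 0.

Definition in_root_space (al : 'rV[rat]_n) (A : 'M[F]_(n + n + 1)) : Prop :=
  A \in so /\ forall j, lie_bracket (cartan j) A = ratr (al 0 j) *: A.

(* A finite-dimensional module, in coordinates: the underlying space is
   'cV[F]_(mdim M), and X in so acts on v by mact M X *m v.  The values of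
   mact M outside so are irrelevant. *)
Record so_module := SoModule {
  mdim : nat;
  mact : 'M[F]_(n + n + 1) -> 'M[F]_mdim;
  mact_linear : forall (a : F) A B, A \in so -> B \in so ->
    mact (a *: A + B) = a *: mact A + mact B;
  mact_bracket : forall A B, A \in so -> B \in so ->
    mact (lie_bracket A B) = lie_bracket (mact A) (mact B)
}.

Section Submodules.
Variable M : so_module.
Implicit Types (U W : {vspace 'cV[F]_(mdim M)}) (la : 'rV[rat]_n).

Definition submodule U : Prop :=
  forall A v, A \in so -> v \in U -> mact M A *m v \in U.

Definition simple_quotient U W : Prop :=
  [/\ submodule U, submodule W, (W <= U)%VS, W != U &
      forall N : {vspace 'cV[F]_(mdim M)}, submodule N ->
        (W <= N)%VS -> (N <= U)%VS -> N = W \/ N = U].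

Definition irreducible : Prop := simple_quotient fullv 0%VS.

(* The quotient U / W (for U / W simple) has highest weight la: the class of
   some v in U is nonzero, has weight la, and is killed by every simple root
   vector. *)
Definition quotient_highest_weight U W la : Prop :=
  exists v : 'cV[F]_(mdim M),
    [/\ v \in U, v \notin W,
        forall i, mact M (cartan i) *m v - ratr (la 0 i) *: v \in W &
        forall i A, in_root_space (simple_root i) A -> mact M A *m v \in W].

Definition has_highest_weight la : Prop :=
  quotient_highest_weight fullv 0%VS la.

Definition composition_series (s : seq {vspace 'cV[F]_(mdim M)}) : Prop :=
  [/\ (0 < size s)%N, head 0%VS s = 0%VS, last 0%VS s = fullv &
      forall k, (k.+1 < size s)%N ->
        simple_quotient (nth 0%VS s k.+1) (nth 0%VS s k)].

Definition composition_factor_highest_weight la : Prop :=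
  exists (s : seq {vspace 'cV[F]_(mdim M)}) (k : nat),
    [/\ composition_series s, (k.+1 < size s)%N &
        quotient_highest_weight (nth 0%VS s k.+1) (nth 0%VS s k) la].

Definition weight_space la : {vspace 'cV[F]_(mdim M)} :=
  (\bigcap_(i < n)
     passmx.leigenspace (linfun (mulmx (mact M (cartan i))))
       (ratr (la 0%R i)))%VS.

(* Weight spaces of distinct weights are independent in characteristic 0, so
   the sum below is direct once s is duplicate-free. *)
Definition weight_decomposable : Prop :=
  exists s : seq 'rV[rat]_n,
    [/\ uniq s, forall la, la \in s -> in_weight_lattice la &
        (\sum_(la <- s) weight_space la)%VS = fullv].

Definition dominant_weight_of la : Prop :=
  dominant la /\ weight_space la <> 0%VS.

Definition saturated : Prop :=
  weight_decomposable /\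
  forall la, composition_factor_highest_weight la <-> dominant_weight_of la.

End Submodules.

Lemma trivial_linear (a : F) (A B : 'M[F]_(n + n + 1)) :
  A \in so -> B \in so -> (0 : 'M[F]_1) = a *: 0 + 0.
Proof. by rewrite scaler0 addr0. Qed.

Lemma trivial_bracket (A B : 'M[F]_(n + n + 1)) :
  A \in so -> B \in so -> (0 : 'M[F]_1) = lie_bracket 0 0.
Proof. by rewrite /lie_bracket mulmx0 subr0. Qed.

Definition trivial_module : so_module :=
  SoModule trivial_linear trivial_bracket.

(* 'cV_d (x) 'cV_e is 'cV_(d * e) through the Kronecker product *t, and A acts
   on a tensor product as A (x) 1 + 1 (x) A. *)
Definition tensor_act (M N : so_module) (A : 'M[F]_(n + n + 1)) :
    'M[F]_(mdim M * mdim N) :=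
  tensmx (mact M A) 1%:M + tensmx 1%:M (mact N A).

Lemma tensor_linear (M N : so_module) (a : F) A B : A \in so -> B \in so ->
  tensor_act M N (a *: A + B) = a *: tensor_act M N A + tensor_act M N B.
Proof.
move=> sA sB; rewrite /tensor_act !mact_linear //.
by apply/matrixP=> i j; rewrite !mxE; ring.
Qed.

Lemma tensor_bracket (M N : so_module) A B : A \in so -> B \in so ->
  tensor_act M N (lie_bracket A B) =
  lie_bracket (tensor_act M N A) (tensor_act M N B).
Proof.
move=> sA sB; rewrite /tensor_act !mact_bracket // /lie_bracket.
rewrite !mulmxDl !mulmxDr !tensmx_mul !mulmx1 !mul1mx.
by apply/matrixP=> i j; rewrite !mxE; ring.
Qed.

Definition tensor_module (M N : so_module) : so_module :=
  SoModule (@tensor_linear M N) (@tensor_bracket M N).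

Fixpoint tensor_power (M : so_module) (r : nat) : so_module :=
  if r is r'.+1 then tensor_module M (tensor_power M r') else trivial_module.

End LieAlgebra.

Arguments so : clear implicits.

(* Main.v *)
From HB Require Import structures.
From mathcomp Require Import all_boot all_order all_algebra.
From mathcomp Require Import ring mxtens zify.
From Stdlib Require Import Classical.
Require Import Defs.

(** The proof goes through the Clifford algebra. As a Lie algebra, so_(2n+1) is
generated by its short root vectors: write X(a), for a in a 2n-dimensional
quadratic space with form B, for the matrix [short a]; then the brackets
[X(a), X(b)] span the subalgebra so_(2n), and [[X(a), X(b)], X(c)] =
B(a, c) X(b) - B(b, c) X(a) ([bracket_short3]). So submodules are the subspaces
stable under the X(a), and modules can be studied through these operators alone.

On the spin module S the X(a) satisfy the Clifford relations
X(a) X(b) + X(b) X(a) = - B(a, b) / 2. They hold on the highest weight vector by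
sl2-theory ([clifford_defect_hwv]), the vectors on which they hold form a submodule
([clifford_stable]), and S is irreducible. After rescaling, the operators X_i, Y_i of
the roots eps_i, - eps_i become annihilators and creators of n fermions
([spin_car]), and 2 H_i becomes the parity of the i-th mode, an involution. Hence S
is spanned by weight vectors of weights (+-1/2, ..., +-1/2), and the weights of the
r-th power lie in {-r/2, -r/2 + 1, ..., r/2}^n ([tensor_power_weights]).

The weight of a composition factor is a weight of the module because the module is
spanned by weight vectors ([weight_mod]), and it is dominant by sl2-theory modulo a
submodule ([sl2_weight_nat]).

Conversely, let la be a dominant weight of the r-th power. It is enough to find a
singular vector of weight la, since the submodule it generates has a simple quotient
of highest weight la ([highest_weight_factor]). Singular vectors can be tensored,
and S (x) S contains, for every k <= n, a singular vector of weight
(1, ..., 1, 0, ..., 0) with k ones: the vacuum on the first k modes of both copies,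
and an invariant that pairs off the remaining modes ([fermion_pairing]). The columns
of the partition la, or of la minus the spin weight when r is odd, are weights of
this form, and there are at most r / 2 of them; so induction from r to r + 2 gives
the singular vector ([tensor_power_singular]). *)

Set Implicit Arguments.
Unset Strict Implicit.
Unset Printing Implicit Defensive.

Import GRing.Theory.
Local Open Scope ring_scope.

(** * Rational weights as scalars in characteristic 0 *)

Section Scalars.
Variable (F : fieldType).
Hypothesis F_char0 : [pchar F] =i pred0.

Lemma natf_eq0 k : (k%:R == 0 :> F) = (k == 0)%N.
Proof. exact: (pcharf0P F).1. Qed.

Lemma intf_eq0 (k : int) : (k%:~R == 0 :> F) = (k == 0).
Proof.
case: k => k; first by rewrite -pmulrn natf_eq0.
by rewrite NegzE mulrNz oppr_eq0 -pmulrn natf_eq0.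
Qed.

(** Denominators are invertible in characteristic 0; this makes [ratr] additive and
injective, although F carries no order. *)
Lemma ratr_frac (a b : int) : b != 0 -> ratr (a%:~R / b%:~R) = a%:~R / b%:~R :> F.
Proof.
move=> b0; set q := a%:~R / b%:~R.
have e : numq q * b = a * denq q.
  apply: (@intr_inj rat); rewrite !rmorphM /=.
  have := divq_num_den q; rewrite {3}/q => /eqP.
  by rewrite eqr_div ?intr_eq0 ?denq_eq0 // => /eqP.
rewrite /ratr; apply/eqP; rewrite eqr_div ?intf_eq0 ?denq_eq0 //.
by rewrite -!rmorphM /= e.
Qed.

Lemma ratrE_frac (q : rat) : q = (numq q)%:~R / (denq q)%:~R.
Proof. by rewrite divq_num_den. Qed.

Lemma ratr_additive (p q : rat) : ratr (p + q) = ratr p + ratr q :> F.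
Proof.
rewrite (ratrE_frac p) (ratrE_frac q).
rewrite addf_div ?intr_eq0 ?denq_eq0 // -!rmorphM -rmorphD /=.
rewrite !ratr_frac ?mulf_neq0 ?denq_eq0 // rmorphD !rmorphM /=.
by rewrite addf_div ?intf_eq0 ?denq_eq0.
Qed.

Lemma ratr_eq0 (q : rat) : ratr q = 0 :> F -> q = 0.
Proof.
move/eqP; rewrite /ratr mulf_eq0 invr_eq0 !intf_eq0 denq_eq0 orbF numq_eq0.
by move/eqP.
Qed.

Lemma ratr0 : ratr 0 = 0 :> F. Proof. exact: (ratr_nat F 0). Qed.

Lemma ratrN (q : rat) : ratr (- q) = - ratr q :> F.
Proof. by apply/eqP; rewrite -addr_eq0 -ratr_additive addNr ratr0. Qed.

Lemma ratrB (p q : rat) : ratr (p - q) = ratr p - ratr q :> F.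
Proof. by rewrite ratr_additive ratrN. Qed.

Lemma ratr_injective : injective (@ratr F).
Proof.
by move=> p q e; apply/eqP; rewrite -subr_eq0; apply/eqP/ratr_eq0; rewrite ratrB e subrr.
Qed.

Lemma ratr_half (k : nat) : ratr (k%:R / 2%:R) = k%:R / 2%:R :> F.
Proof. by have := @ratr_frac k 2 isT; rewrite -!pmulrn. Qed.

Lemma two_neq0 : 2%:R != 0 :> F. Proof. by rewrite natf_eq0. Qed.

End Scalars.

(** * Generation of so_(2n+1) by short root vectors *)

Section LieAlgebraStructure.
Variables (F : fieldType) (n : nat).
Hypothesis F_char0 : [pchar F] =i pred0.
Implicit Types a b c : 'cV[F]_(n + n).

Definition gram : 'M[F]_(n + n) := block_mx 0 1%:M 1%:M 0.

Lemma gram_tr : gram^T = gram.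
Proof. by rewrite /gram tr_block_mx !trmx0 !trmx1. Qed.

Lemma gram_sq : gram *m gram = 1%:M.
Proof.
by rewrite /gram mulmx_block !mul0mx !mulmx0 !mul1mx !addr0 !add0r -scalar_mx_block.
Qed.

Definition bform a b : F := (a^T *m gram *m b) 0 0.

Lemma bformC a b : bform a b = bform b a.
Proof.
rewrite /bform -[in RHS](trmxK (b^T *m gram *m a)) [RHS]mxE.
by rewrite !trmx_mul trmxK gram_tr mulmxA.
Qed.

Lemma bform_scalar a b : a^T *m gram *m b = (bform a b)%:M.
Proof. by rewrite [LHS]mx11_scalar. Qed.

(** The matrices [short a] and [long D] are the odd and even parts of so_(2n+1) for
the decomposition V + 1 of its natural module, where V has dimension 2n and the
form [gram]. The basis vectors of V give the short root vectors. *)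
Definition short a : 'M[F]_(n + n + 1) := block_mx 0 a (- (a^T *m gram)) 0.

Definition long (D : 'M[F]_(n + n)) : 'M[F]_(n + n + 1) := block_mx D 0 0 0.

Lemma so_formE : so_form F n = block_mx gram 0 0 1%:M.
Proof. by []. Qed.

Lemma short_so a : short a \in so F n.
Proof.
apply/eqP; rewrite so_formE /short tr_block_mx !mulmx_block.
rewrite !trmx0 !mul0mx !mulmx0 !mulmx1 !mul1mx !addr0 !add0r.
rewrite linearN /= trmx_mul trmxK gram_tr add_block_mx !addr0 addNr subrr.
by rewrite block_mx0.
Qed.

Lemma short_linear (k : F) a b : short (k *: a + b) = k *: short a + short b.
Proof.
rewrite /short scale_block_mx add_block_mx !scaler0 !addr0.
by rewrite linearP /= mulmxDl -scalemxAl opprD scalerN.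
Qed.

Lemma bracket_so (A B : 'M[F]_(n + n + 1)) :
  A \in so F n -> B \in so F n -> lie_bracket A B \in so F n.
Proof.
rewrite !inE /lie_bracket => /eqP hA /eqP hB; apply/eqP.
set G := so_form F n in hA hB *.
have eA : A^T *m G = - (G *m A) by apply/eqP; rewrite -addr_eq0 hA.
have eB : B^T *m G = - (G *m B) by apply/eqP; rewrite -addr_eq0 hB.
rewrite linearB /= !trmx_mul mulmxBl mulmxBr.
rewrite -!mulmxA eA eB !mulmxN !mulmxA eA eB !mulNmx !opprK.
by apply/eqP; rewrite addr_eq0 opprB.
Qed.

Lemma lin_so (k : F) (A B : 'M[F]_(n + n + 1)) :
  A \in so F n -> B \in so F n -> k *: A + B \in so F n.
Proof.
rewrite !inE => /eqP hA /eqP hB; apply/eqP.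
rewrite linearP /= mulmxDl mulmxDr -scalemxAl -scalemxAr addrACA hB addr0.
by rewrite -scalerDr hA scaler0.
Qed.

Lemma so0 : 0 \in so F n.
Proof. by rewrite inE trmx0 mul0mx mulmx0 addr0. Qed.

Lemma bracket_short a b :
  lie_bracket (short a) (short b) = long (b *m a^T *m gram - a *m b^T *m gram).
Proof.
rewrite /lie_bracket /short /long !mulmx_block !mul0mx !mulmx0 !addr0 !add0r.
rewrite opp_block_mx add_block_mx !oppr0 !addr0 !mulmxN !mulNmx !opprK.
rewrite !bform_scalar bformC addNr !mulmxA.
by congr block_mx; rewrite addrC.
Qed.

(** The bracket of two short matrices rotates V in the plane of a and b. *)
Lemma bracket_short3 a b c :
  lie_bracket (lie_bracket (short a) (short b)) (short c) =
  short (bform a c *: b - bform b c *: a).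
Proof.
rewrite bracket_short /lie_bracket /short /long.
rewrite !mulmx_block !mul0mx !mulmx0 !addr0.
rewrite opp_block_mx add_block_mx !oppr0 ?addr0 ?add0r.
have -> : (b *m a^T *m gram - a *m b^T *m gram) *m c = bform a c *: b - bform b c *: a.
  have h (u w : 'cV[F]_(n + n)) : u *m w^T *m gram *m c = bform w c *: u.
    by rewrite -2!(mulmxA u) bform_scalar mul_mx_scalar.
  by rewrite mulmxBl !h.
congr block_mx; rewrite mulNmx opprK mulmxBr.
have h (u w : 'cV[F]_(n + n)) : c^T *m gram *m (u *m w^T *m gram) = bform u c *: (w^T *m gram).
  by rewrite -(mulmxA u) (mulmxA (c^T *m gram)) bform_scalar mul_scalar_mx bformC.
by rewrite !h linearB /= mulmxBl ![(_ *: _)^T]linearZ /= -!scalemxAl opprB.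
Qed.

Definition xv (i : 'I_n) : 'cV[F]_(n + n) := delta_mx (lshift n i) 0.
Definition yv (i : 'I_n) : 'cV[F]_(n + n) := delta_mx (rshift n i) 0.

Lemma bform_delta i j : bform (delta_mx i 0) (delta_mx j 0) = gram i j.
Proof.
rewrite /bform trmx_delta -rowE -colE !mxE /=; reflexivity.
Qed.

Lemma bform_xx i j : bform (xv i) (xv j) = 0.
Proof. by rewrite bform_delta /gram block_mxEul mxE. Qed.
Lemma bform_yy i j : bform (yv i) (yv j) = 0.
Proof. by rewrite bform_delta /gram block_mxEdr mxE. Qed.
Lemma bform_xy i j : bform (xv i) (yv j) = (i == j)%:R.
Proof. by rewrite bform_delta /gram block_mxEur mxE. Qed.
Lemma bform_yx i j : bform (yv i) (xv j) = (i == j)%:R.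
Proof. by rewrite bformC bform_xy eq_sym. Qed.


Lemma cartanE i : cartan F i = lie_bracket (short (yv i)) (short (xv i)).
Proof.
rewrite bracket_short /cartan /long; congr block_mx.
rewrite /xv /yv !trmx_delta !mul_delta_mx /gram.
rewrite -mulmxBl !delta_mx_ushift !delta_mx_dshift !delta_mx_lshift !delta_mx_rshift.
rewrite !block_mxEv opp_col_mx add_col_mx opp_row_mx !oppr0 addr0 add0r.
rewrite mul_col_mx !mul_row_col !mul0mx !addr0 add0r.
by rewrite mul_mx_row mulmx1 mulmx0 mul_mx_row mulmx1 mulmx0.
Qed.

Lemma cartan_so i : cartan F i \in so F n.
Proof. by rewrite cartanE; apply: bracket_so; apply: short_so. Qed.

(** The j-th coordinate of the weight eps_i or - eps_i of the p-th basis vector of V. *)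
Definition vwt (p : 'I_(n + n)) (j : 'I_n) : int :=
  (p == lshift n j)%:Z - (p == rshift n j)%:Z.

(** In this form, ad H_j acts on matrix entries by differences of weights. *)
Lemma cartan_diag j :
  cartan F j = long (diag_mx (\row_p (vwt p j)%:~R)).
Proof.
rewrite /cartan /long; congr block_mx; apply/matrixP=> p q; rewrite !mxE /vwt.
rewrite rmorphB /= -!pmulrn.
case: (split_ordP p) => i ->; rewrite ?mxE; case: (split_ordP q) => k ->; rewrite !mxE;
 rewrite ?eq_lshift ?eq_rshift ?eq_lrshift ?eq_rlshift ?mulr0n ?subr0 ?sub0r //;
 case: (eqVneq i k) => [<-|nik]; rewrite ?andbb ?mulr1n ?mulr0n //;
 case: (eqVneq i j) => [<-|nij]; rewrite ?(negPf nik) ?andbF ?oppr0 ?eqxx //=.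
- by rewrite eq_sym (negPf nik).
- by rewrite eq_sym (negPf nik) oppr0.
Qed.

(** For D in so_(2n), the matrix D *m gram is skew, which makes D a combination of the
infinitesimal rotations [sv q, sv p] in [long_sum]. *)
Lemma so_decomp A : A \in so F n ->
  exists a D, A = short a + long D /\ (D *m gram)^T = - (D *m gram).
Proof.
rewrite inE so_formE -[A]submxK => /eqP.
set D := ulsubmx A; set a := ursubmx A; set b := dlsubmx A; set z := drsubmx A.
rewrite tr_block_mx !mulmx_block !mulmx0 !mul0mx !mulmx1 !mul1mx !addr0 !add0r.
rewrite add_block_mx => e; move: (e).
rewrite -[RHS](block_mx0 F (n + n) 1 (n + n) 1) => /eq_block_mx [e1 _ e3 e4].
exists a, D; split.
  have -> : b = - (a^T *m gram) by apply/eqP; rewrite -addr_eq0 addrC e3.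
  have -> : z = 0.
    move: e4; rewrite [z]mx11_scalar tr_scalar_mx -raddfD /= => /matrixP/(_ 0 0).
    rewrite !mxE /= !mulr1n -mulr2n -mulr_natl => /eqP.
    by rewrite mulf_eq0 (negPf (two_neq0 F_char0)) => /eqP ->; rewrite raddf0.
  by rewrite /short /long add_block_mx !addr0 add0r.
have eD : D^T *m gram = - (gram *m D) by apply/eqP; rewrite -addr_eq0 e1.
rewrite trmx_mul gram_tr -[D^T]mulmx1 -gram_sq (mulmxA D^T) eD.
by rewrite mulNmx mulmxN !mulmxA gram_sq mul1mx.
Qed.

Lemma vec_sum_delta a : a = \sum_p a p 0 *: delta_mx p 0.
Proof. by rewrite {1}[a]matrix_sum_delta; apply: eq_bigr => p _; rewrite big_ord1. Qed.

(** The short root vector given by the p-th basis vector of V. *)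
Definition sv p : 'M[F]_(n + n + 1) := short (delta_mx p 0).

Lemma short_sum a : short a = \sum_p a p 0 *: sv p.
Proof.
have h (r : seq 'I_(n + n)) :
    short (\sum_(p <- r) a p 0 *: delta_mx p 0) = \sum_(p <- r) a p 0 *: sv p.
  elim: r => [|p r IH]; last by rewrite !big_cons short_linear IH.
  by rewrite !big_nil /short trmx0 mul0mx oppr0 block_mx0.
by rewrite {1}(vec_sum_delta a) h.
Qed.

Lemma long_sum D : (D *m gram)^T = - (D *m gram) ->
  long D = \sum_p \sum_q (2%:R^-1 * (D *m gram) p q) *: lie_bracket (sv q) (sv p).
Proof.
move=> skew; set K := D *m gram in skew *.
have long_lin (k : F) D1 D2 : long (k *: D1 + D2) = k *: long D1 + long D2.
  by rewrite /long scale_block_mx add_block_mx !scaler0 !addr0.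
have long0 : long 0 = 0 by rewrite /long block_mx0.
have longD D1 D2 : long (D1 + D2) = long D1 + long D2.
  by rewrite -[D1]scale1r long_lin !scale1r.
have longZ k D1 : long (k *: D1) = k *: long D1.
  by rewrite -[k *: D1]addr0 long_lin long0 addr0.
have {1}-> : D = 2%:R^-1 *: ((K - K^T) *m gram).
  rewrite skew opprK -mulr2n -scaler_nat -scalemxAl scalerA mulVf ?two_neq0 //.
  by rewrite scale1r -mulmxA gram_sq mulmx1.
have -> : K - K^T = \sum_p \sum_q K p q *: (delta_mx p q - delta_mx q p).
  rewrite {1 2}[K]matrix_sum_delta linear_sum -sumrB; apply: eq_bigr => p _.
  rewrite linear_sum -sumrB; apply: eq_bigr => q _.
  by rewrite linearZ /= trmx_delta scalerBr.
rewrite mulmx_suml scaler_sumr (big_morph long longD long0).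
apply: eq_bigr => p _; rewrite mulmx_suml scaler_sumr (big_morph long longD long0).
apply: eq_bigr => q _; rewrite bracket_short !trmx_delta !mul_delta_mx -mulmxBl.
by rewrite -scalemxAl scalerA longZ.
Qed.

Section Generation.
Variable P : 'M[F]_(n + n + 1) -> Prop.
Hypothesis P0 : P 0.
Hypothesis P_lin : forall k A B,
  A \in so F n -> B \in so F n -> P A -> P B -> P (k *: A + B).

Lemma sum_closed (I : Type) (r : seq I) (k : I -> F) (A : I -> 'M[F]_(n + n + 1)) :
  (forall i, A i \in so F n) -> (forall i, k i != 0 -> P (A i)) ->
  (\sum_(i <- r) k i *: A i \in so F n) /\ P (\sum_(i <- r) k i *: A i).
Proof.
move=> Aso PA; elim: r => [|i r [IH1 IH2]]; first by rewrite big_nil so0.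
rewrite big_cons; split; first exact: lin_so.
have [->|k0] := eqVneq (k i) 0; first by rewrite scale0r add0r.
by apply: P_lin => //; apply: PA.
Qed.

Lemma short_long_ind a D : (D *m gram)^T = - (D *m gram) ->
  (forall p, a p 0 != 0 -> P (sv p)) ->
  (forall p q, (D *m gram) p q != 0 -> P (lie_bracket (sv q) (sv p))) ->
  P (short a + long D).
Proof.
move=> skew Pa PD; rewrite short_sum (long_sum skew).
have [s1 p1] := @sum_closed _ (index_enum _) (fun p => a p 0) sv
  (fun p => short_so _) Pa.
rewrite pair_big /=.
have [] := @sum_closed _ (index_enum _) (fun u => 2%:R^-1 * (D *m gram) u.1 u.2)
  (fun u => lie_bracket (sv u.2) (sv u.1)).
- by move=> u; apply: bracket_so; apply: short_so.
- by move=> u; rewrite mulf_eq0 negb_or => /andP[_ /PD].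
by move=> s2 p2; rewrite -[X in P (X + _)]scale1r; apply: P_lin.
Qed.

Lemma so_ind A : A \in so F n -> (forall p, P (sv p)) ->
  (forall p q, P (lie_bracket (sv q) (sv p))) -> P A.
Proof. by move=> /so_decomp[a [D [-> skew]]] Pa PD; apply: short_long_ind. Qed.

(** Only the generators of weight alpha contribute to an element of the root space
of alpha: a property closed under linear combinations has to be checked on these
alone. *)
Lemma root_space_ind (al : 'rV[rat]_n) (z : 'I_n -> int) A :
  (forall j, al 0 j = (z j)%:~R) -> in_root_space al A ->
  (forall p, (forall j, vwt p j = z j) -> P (sv p)) ->
  (forall p q, (forall j, vwt p j + vwt q j = z j) -> P (lie_bracket (sv q) (sv p))) ->
  P A.
Proof.
move=> alz [/so_decomp[a [D [-> skew]]] rt] Pa PD.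
set K := D *m gram in skew.
have eD : D = K *m gram by rewrite -mulmxA gram_sq mulmx1.
(* Weights are integral, so they can be compared in F. *)
have hint (k l : int) (x : F) : x != 0 -> k%:~R * x = l%:~R * x -> k = l.
  move=> x0 e; apply/eqP; rewrite -subr_eq0 -(intf_eq0 F_char0) rmorphB /= subr_eq0.
  by apply/eqP; apply: (mulIf x0).
have {}rt j : let h := diag_mx (\row_p (vwt p j)%:~R) in
  h *m D - D *m h = (z j)%:~R *: D /\ h *m a = (z j)%:~R *: a.
  move: (rt j); rewrite alz ratr_int cartan_diag /lie_bracket /short /long.
  rewrite !add_block_mx !mulmx_block !(mulmx0, mul0mx, addr0, add0r).
  rewrite opp_block_mx add_block_mx scale_block_mx.
  by rewrite !oppr0 !addr0 => /eq_block_mx[].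
apply: short_long_ind => // [p ap|p q Kpq].
  apply: Pa => j; have [_ /matrixP/(_ p 0)] := rt j.
  by rewrite mul_diag_mx !mxE; apply: hint.
apply: PD => j; have [/(congr1 (fun X => X *m gram)) e _] := rt j.
set h := diag_mx _ in e.
have hJ : h *m gram = - (gram *m h).
  apply/matrixP => u v; rewrite mul_diag_mx mul_mx_diag !mxE /vwt !rmorphB /= -!pmulrn.
  case: (split_ordP u) => i ->; rewrite ?mxE; case: (split_ordP v) => k ->;
    rewrite ?mxE ?mulr0 ?mul0r ?oppr0 // ?eq_lshift ?eq_rshift ?eq_lrshift ?eq_rlshift.
  - case: (eqVneq i k) => [<-|nik]; last by rewrite mulr0 mul0r oppr0.
    by rewrite mulr1 mul1r subr0 sub0r opprK.
  case: (eqVneq i k) => [<-|nik]; last by rewrite mulr0 mul0r oppr0.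
  by rewrite mulr1 mul1r subr0 sub0r.
have {e} : h *m K + K *m h = (z j)%:~R *: K.
  by move: e; rewrite mulmxBl -scalemxAl -!mulmxA hJ !mulmxN opprK !mulmxA.
move: Kpq; rewrite -/K; move: (K) => K' Kpq /matrixP/(_ p q).
rewrite mxE mul_diag_mx mul_mx_diag !mxE.
by rewrite [K' p q * _]mulrC -mulrDl -rmorphD /=; apply: hint.
Qed.

End Generation.

End LieAlgebraStructure.

(** * Representations of sl2 modulo an invariant subspace *)

Section Brackets.
Variables (F : fieldType) (d : nat).
Implicit Types A B C : 'M[F]_d.

Lemma jacobi A B C : lie_bracket A (lie_bracket B C) =
  lie_bracket (lie_bracket A B) C + lie_bracket B (lie_bracket A C).
Proof.
rewrite /lie_bracket !(mulmxBl, mulmxBr) !mulmxA.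
move: (A *m B *m C) (A *m C *m B) (B *m C *m A) (C *m B *m A) (B *m A *m C)
  (C *m A *m B) => p q r s t u.
by apply/matrixP=> i j; rewrite !mxE; ring.
Qed.

Lemma bracketC A B : lie_bracket A B = - lie_bracket B A.
Proof. by rewrite /lie_bracket opprB. Qed.

Lemma bracketZl k A B : lie_bracket (k *: A) B = k *: lie_bracket A B.
Proof. by rewrite /lie_bracket -scalemxAl -scalemxAr scalerBr. Qed.

Lemma bracketZr k A B : lie_bracket A (k *: B) = k *: lie_bracket A B.
Proof. by rewrite /lie_bracket -scalemxAl -scalemxAr scalerBr. Qed.

Lemma bracketBl A B C : lie_bracket (A - B) C = lie_bracket A C - lie_bracket B C.
Proof.
rewrite /lie_bracket mulmxBl mulmxBr.
by apply/matrixP=> i j; rewrite !mxE; ring.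
Qed.

Lemma bracket_wt A B C (k l : F) : lie_bracket A B = k *: B ->
  lie_bracket A C = l *: C -> lie_bracket A (lie_bracket B C) = (k + l) *: lie_bracket B C.
Proof. by move=> eB eC; rewrite jacobi eB eC bracketZl bracketZr -scalerDl. Qed.

Lemma bracket_mulmx A B (v : 'cV[F]_d) :
  A *m (B *m v) = B *m (A *m v) + lie_bracket A B *m v.
Proof. by rewrite /lie_bracket mulmxBl -!mulmxA addrC subrK. Qed.

End Brackets.

Section SL2.
Variables (F : fieldType) (d : nat).
Hypothesis F_char0 : [pchar F] =i pred0.
Variables (e f h : 'M[F]_d) (W : {vspace 'cV[F]_d}).
Hypothesis ef : lie_bracket e f = h.
Hypothesis hf : lie_bracket h f = (- 2%:R) *: f.
Hypothesis W_e : forall w, w \in W -> e *m w \in W.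
Hypothesis W_f : forall w, w \in W -> f *m w \in W.
Hypothesis W_h : forall w, w \in W -> h *m w \in W.
Variables (v : 'cV[F]_d) (c : F).
Hypothesis vW : v \notin W.
Hypothesis ev : e *m v \in W.
Hypothesis hv : h *m v - c *: v \in W.

Let fp k := iter k (mulmx f) v.

Lemma sl2_string_weight k : h *m fp k - (c - (2 * k)%:R) *: fp k \in W.
Proof.
elim: k => [|k IH]; first by rewrite subr0.
rewrite -[fp k.+1]/(f *m fp k) bracket_mulmx hf -scalemxAl.
have -> : f *m (h *m fp k) + - 2%:R *: (f *m fp k) -
    (c - (2 * k.+1)%:R) *: (f *m fp k) = f *m (h *m fp k - (c - (2 * k)%:R) *: fp k).
  rewrite mulmxBr -scalemxAr; move: (f *m (h *m fp k)) (f *m fp k) => p q.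
  by apply/matrixP=> i j; rewrite !mxE mulnS natrD; ring.
exact: W_f.
Qed.

Lemma sl2_string_raise k :
  e *m fp k.+1 - (k.+1%:R * (c - k%:R)) *: fp k \in W.
Proof.
elim: k => [|k IH].
  rewrite -[fp 1]/(f *m v) bracket_mulmx ef -addrA subr0 mul1r.
  by apply: rpredD => //; apply: W_f.
rewrite -[fp k.+2]/(f *m fp k.+1) bracket_mulmx ef.
have -> : f *m (e *m fp k.+1) + h *m fp k.+1 - (k.+2%:R * (c - k.+1%:R)) *: fp k.+1 =
  f *m (e *m fp k.+1 - (k.+1%:R * (c - k%:R)) *: fp k) +
  (h *m fp k.+1 - (c - (2 * k.+1)%:R) *: fp k.+1).
  rewrite mulmxBr -scalemxAr -[f *m fp k]/(fp k.+1).
  move: (f *m (e *m fp k.+1)) (h *m fp k.+1) (fp k.+1) => p q r.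
  apply/matrixP=> i j; rewrite !mxE mulnS natrD mul2n -addnn natrD.
  by rewrite -[k.+2]addn1 -[k.+1]addn1 !natrD; ring.
by apply: rpredD; [apply: W_f | apply: sl2_string_weight].
Qed.

(** Otherwise the f ^ k v would be independent modulo W, as they have distinct
weights. *)
Lemma sl2_string_stops : exists k, fp k \in W.
Proof.
apply: NNPP => no; have {no} out k : fp k \notin W.
  by apply/negP=> ?; apply: no; exists k.
(* V k is W + <v, f v, ..., f ^ (k - 1) v>. *)
pose V k := iteri k (fun j U => U + <[fp j]>)%VS W.
have WV k u : u \in W -> u \in V k.
  by move=> uW; elim: k => //= k IH; apply: (subvP (addvSl _ _)).
have hV k u : u \in V k -> h *m u \in V k.
  elim: k u => [|k IH] u /=; first exact: W_h.
  case/memv_addP=> u1 u1V [_ /vlineP[a ->] ->].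
  rewrite mulmxDr -scalemxAr rpredD ?rpredZ //.
    by apply: (subvP (addvSl _ _)); apply: IH.
  rewrite -[h *m _](subrK ((c - (2 * k)%:R) *: fp k)) rpredD //.
    by apply: (subvP (addvSl _ _)); apply: WV; apply: sl2_string_weight.
  by rewrite rpredZ // (subvP (addvSr _ _)) // memv_line.
have fpV j : fp j \notin V j.
  apply/negP; suff: forall k, (k <= j)%N -> fp j \in V k -> fp j \in W.
    by move=> H; move/(H _ (leqnn j)); apply/negP.
  elim=> [//|k IH] ltkj; case/memv_addP=> u uV [_ /vlineP[a ->] E].
  apply: IH; first exact: ltnW.
  set ck := c - (2 * k)%:R; set cj := c - (2 * j)%:R.
  have c0 : cj - ck != 0.
    have -> : cj - ck = - (2 * (j - k))%:R.
      by rewrite /cj /ck !natrM natrB 1?ltnW //; ring.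
    by rewrite oppr_eq0 natf_eq0 //; lia.
  (* h - ck sends V k.+1 into V k and multiplies the class of fp j by cj - ck. *)
  have : h *m fp j - ck *: fp j \in V k.
    rewrite E mulmxDr scalerDr opprD addrACA rpredD //.
      by rewrite rpredB ?hV ?rpredZ.
    rewrite -scalemxAr scalerA [ck * a]mulrC -scalerA -scalerBr rpredZ //.
    by apply: WV; apply: sl2_string_weight.
  have -> : h *m fp j - ck *: fp j = (h *m fp j - cj *: fp j) + (cj - ck) *: fp j.
    by rewrite (scalerBl cj ck) addrA subrK.
  rewrite rpredDl; last by apply: WV; apply: sl2_string_weight.
  by rewrite rpredZeq (negPf c0).
have dimV k : (k <= \dim (V k))%N.
  elim: k => //= k IH; apply: leq_ltn_trans IH _.
  rewrite (ltn_leqif (dimv_leqif_sup (addvSl _ _))).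
  apply/negP => /subvP/(_ (fp k)); rewrite (subvP (addvSr _ _)) ?memv_line //.
  by move=> /(_ isT); apply/negP.
have := leq_trans (dimV d.+1) (dimvS (subvf _)).
by rewrite dimvf /dim /= muln1 ltnn.
Qed.

(** In a finite-dimensional representation of sl2, the weight of a vector killed
by e is a natural number: the string v, f v, ... stops, and e recovers each
vector from the next with the coefficient (k + 1)(c - k). *)
Lemma sl2_weight_nat : exists k : nat, c = k%:R.
Proof.
have ex : exists k, fp k \in W := sl2_string_stops.
case: (ex_minnP ex) => [[|k] fk mink]; first by rewrite /= (negPf vW) in fk.
exists k; apply/eqP; rewrite -subr_eq0.
have : (k.+1%:R * (c - k%:R)) *: fp k \in W.
  by have := rpredB (W_e fk) (sl2_string_raise k); rewrite opprB addrC subrK.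
rewrite rpredZeq mulf_eq0 natf_eq0 //= => /orP[//|/mink].
by rewrite ltnn.
Qed.

End SL2.

Section SL2Corollary.
Variables (F : fieldType) (d : nat).
Hypothesis F_char0 : [pchar F] =i pred0.

(** e sends f ^ (k + 1) v to a multiple of f ^ k v whose coefficient vanishes, so
f ^ (k + 1) v would be killed by e while having the weight - k - 2. *)
Lemma sl2_string_zero (e f h : 'M[F]_d) (v : 'cV[F]_d) k :
  lie_bracket e f = h -> lie_bracket h f = (- 2%:R) *: f ->
  e *m v = 0 -> h *m v = k%:R *: v -> iter k.+1 (mulmx f) v = 0.
Proof.
move=> ef hf ev hv; apply/eqP/contraT => fv0.
have st (A : 'M[F]_d) (w : 'cV[F]_d) : w \in 0%VS -> A *m w \in 0%VS.
  by rewrite !memv0 => /eqP ->; rewrite mulmx0.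
have v0 : v \notin 0%VS.
  rewrite memv0; apply: contraNneq fv0 => ->.
  by elim: (k.+1) => //= m /eqP ->; rewrite mulmx0.
have hv' : h *m v - k%:R *: v \in 0%VS by rewrite memv0 hv subrr.
have ev' : e *m v \in 0%VS by rewrite memv0 ev.
have raise := sl2_string_raise ef hf (st f) ev' hv' k.
rewrite subrr mulr0 scale0r subr0 in raise.
have wt := sl2_string_weight hf (st f) hv' k.+1.
have w0 : iter k.+1 (mulmx f) v \notin 0%VS by rewrite memv0.
have [m em] := sl2_weight_nat F_char0 ef hf (st e) (st f) (st h) w0 raise wt.
have : (m + k + 2)%:R == 0 :> F.
  by rewrite !natrD -em natrM -[k.+1]addn1 natrD; apply/eqP; ring.
by rewrite natf_eq0 //; lia.
Qed.

End SL2Corollary.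

(** * Simple roots, weights of modules and dominance *)

Section RootVectors.
Variables (F : fieldType) (n : nat).

Lemma sv_so p : sv F p \in so F n.
Proof. exact: short_so. Qed.

Lemma svsv_so p q : lie_bracket (sv F p) (sv F q) \in so F n.
Proof. by apply: bracket_so; apply: sv_so. Qed.

Lemma short0 : short (0 : 'cV[F]_(n + n)) = 0.
Proof. by rewrite /short trmx0 mul0mx oppr0 block_mx0. Qed.

Lemma shortZ (k : F) (a : 'cV[F]_(n + n)) : short (k *: a) = k *: short a.
Proof. by rewrite -[k *: a]addr0 short_linear short0 addr0. Qed.

Lemma cartan_sv (j : 'I_n) p :
  lie_bracket (cartan F j) (sv F p) = (vwt p j)%:~R *: sv F p.
Proof.
rewrite cartanE bracket_short3 -shortZ; congr short.
rewrite /vwt rmorphB /= -!pmulrn.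
case: (split_ordP p) => i ->.
  rewrite -/(xv F i) bform_yx bform_xx eq_lshift eq_lrshift eq_sym.
  by case: eqVneq => [->|_]; rewrite ?scale0r !subr0 // scale0r.
rewrite -/(yv F i) bform_yy bform_xy eq_rshift eq_rlshift eq_sym.
by case: eqVneq => [->|_]; rewrite ?scale0r !sub0r ?oppr0 ?scale0r // scaleN1r scale1r.
Qed.

Lemma cartan_svsv (j : 'I_n) p q :
  lie_bracket (cartan F j) (lie_bracket (sv F p) (sv F q)) =
  (vwt p j + vwt q j)%:~R *: lie_bracket (sv F p) (sv F q).
Proof. by rewrite rmorphD /=; apply: bracket_wt; apply: cartan_sv. Qed.

Lemma cartan_comm i j : lie_bracket (cartan F i) (cartan F j) = 0 :> 'M_(n + n + 1).
Proof.
rewrite [X in lie_bracket _ X]cartanE cartan_svsv /vwt.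
rewrite !eq_lshift !eq_rshift !eq_lrshift !eq_rlshift.
suff -> : (0%:Z - (j == i)%:Z + ((j == i)%:Z - 0%:Z)) = 0 by rewrite scale0r.
by rewrite subr0 sub0r addNr.
Qed.

End RootVectors.

Section SimpleRoots.
Variables (n : nat).
Implicit Types i j : 'I_n.

Lemma epsE k j : eps n k 0 j = (j == k :> nat)%:R.
Proof. by rewrite mxE. Qed.

Definition simple_root_coord i j : int :=
  if i.+1 == n then (j == i :> nat)%:Z
  else (j == i :> nat)%:Z - (j == i.+1 :> nat)%:Z.

Lemma simple_rootE i j : simple_root i 0 j = (simple_root_coord i j)%:~R.
Proof.
rewrite /simple_root /simple_root_coord; case: ifP => _; first by rewrite epsE.
by rewrite !mxE rmorphB.
Qed.

Lemma coord_last i j : i.+1 = n -> simple_root_coord i j = (j == i :> nat)%:Z.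
Proof. by move=> e; rewrite /simple_root_coord e eqxx. Qed.

Lemma coord_next i i' j : i.+1 = i' ->
  simple_root_coord i j = (j == i :> nat)%:Z - (j == i' :> nat)%:Z.
Proof.
by move=> e; rewrite /simple_root_coord e; case: eqP (ltn_ord i') => // ->; rewrite ltnn.
Qed.

Lemma pairing_eps (k : 'I_n) (la : 'rV[rat]_n) : pairing (eps n k) la = la 0 k.
Proof.
rewrite /pairing (bigD1 k) //= epsE eqxx mul1r big1 ?addr0 // => j nk.
by rewrite epsE [_ == _ :> nat](negPf nk) mul0r.
Qed.

Lemma pairing_last i (la : 'rV[rat]_n) : i.+1 = n ->
  pairing (simple_coroot i) la = 2%:R * la 0 i.
Proof.
move=> e; rewrite /simple_coroot e eqxx -(pairing_eps i) /pairing mulr_sumr.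
by apply: eq_bigr => j _; rewrite mxE mulrA.
Qed.

Lemma pairing_next i i' (la : 'rV[rat]_n) : i.+1 = i' ->
  pairing (simple_coroot i) la = la 0 i - la 0 i'.
Proof.
move=> e; rewrite /simple_coroot -(pairing_eps i) -(pairing_eps i') /pairing e.
rewrite ltn_eqF // -sumrB; apply: eq_bigr => j _.
by rewrite mxE [X in _ + X]mxE mulrBl.
Qed.

End SimpleRoots.

Section Modules.
Variables (F : fieldType) (n : nat).
Hypothesis F_char0 : [pchar F] =i pred0.
Variable M : so_module F n.
Implicit Types (U W : {vspace 'cV[F]_(mdim M)}) (la : 'rV[rat]_n).
Implicit Types (u v w : 'cV[F]_(mdim M)).

Lemma mact0 : mact M 0 = 0.
Proof.
have := mact_linear M (-1) (so0 F n) (so0 F n).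
by rewrite scaler0 addr0 scaleN1r addNr.
Qed.

Lemma mactZ k A : A \in so F n -> mact M (k *: A) = k *: mact M A.
Proof. by move=> sA; rewrite -[k *: A]addr0 mact_linear ?so0 // mact0 addr0. Qed.

(** The operators of root vectors for eps_i and - eps_i, normalised so that
[Y_i, X_i] = H_i. *)
Definition opX i : 'M[F]_(mdim M) := mact M (short (xv F i)).
Definition opY i : 'M[F]_(mdim M) := mact M (short (yv F i)).
Definition opH i : 'M[F]_(mdim M) := mact M (cartan F i).

Lemma mact_short3 (a b c : 'cV[F]_(n + n)) :
  lie_bracket (lie_bracket (mact M (short a)) (mact M (short b))) (mact M (short c)) =
  bform a c *: mact M (short b) - bform b c *: mact M (short a).
Proof.
rewrite -!mact_bracket ?bracket_so ?short_so // bracket_short3.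
by rewrite addrC -scaleNr short_linear mact_linear ?short_so // shortZ mactZ ?short_so //
  scaleNr addrC.
Qed.

Lemma bracket_YX i : lie_bracket (opY i) (opX i) = opH i.
Proof. by rewrite /opH cartanE mact_bracket ?short_so. Qed.

Lemma bracket_XY i : lie_bracket (opX i) (opY i) = - opH i.
Proof. by rewrite bracketC bracket_YX. Qed.

(** Stability under brackets is automatic. *)
Lemma submodule_short U :
  (forall p v, v \in U -> mact M (sv F p) *m v \in U) -> submodule U.
Proof.
move=> hU A v sA; move: v.
apply: (so_ind (P := fun B => forall v, v \in U -> mact M B *m v \in U) F_char0 _ _ sA) => //.
- by move=> v _; rewrite mact0 mul0mx mem0v.
- move=> k B C sB sC PB PC v vU; rewrite mact_linear // mulmxDl -scalemxAl.
  by rewrite rpredD ?rpredZ ?PB ?PC.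
- move=> p q v vU; rewrite mact_bracket ?sv_so // /lie_bracket mulmxBl -!mulmxA.
  by rewrite rpredB ?hU ?hU.
Qed.

Lemma submodule0 : submodule (0%VS : {vspace 'cV[F]_(mdim M)}).
Proof. by move=> A v _; rewrite !memv0 => /eqP ->; rewrite mulmx0. Qed.

Lemma submodulef : submodule (fullv : {vspace 'cV[F]_(mdim M)}).
Proof. by move=> A v _ _; rewrite memvf. Qed.

Lemma weight_spaceP la v :
  reflect (forall i, opH i *m v = ratr (la 0 i) *: v) (v \in weight_space M la).
Proof.
have eigE i : (v \in passmx.leigenspace (linfun (mulmx (mact M (cartan F i))))
    (ratr (la 0 i))) = (opH i *m v == ratr (la 0 i) *: v).
  by rewrite memv_ker !lfun_simp /= subr_eq0.
apply: (iffP idP) => [h i|h].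
  apply/eqP; rewrite -eigE; move: v h {eigE}; apply/subvP.
  exact: (bigcapv_inf i isT (subvv _)).
by apply/subv_bigcapP => i _; rewrite -memvE eigE h.
Qed.

Lemma cartan_act_comm i j v : opH i *m (opH j *m v) = opH j *m (opH i *m v).
Proof.
by rewrite bracket_mulmx -mact_bracket ?cartan_so // cartan_comm mact0 mul0mx addr0.
Qed.

Lemma weight_sum_stable (s : seq 'rV[rat]_n) i v :
  v \in (\sum_(mu <- s) weight_space M mu)%VS ->
  opH i *m v \in (\sum_(mu <- s) weight_space M mu)%VS.
Proof.
elim: s v => [|mu s IH] v; first by rewrite big_nil memv0 => /eqP ->; rewrite mulmx0 mem0v.
rewrite big_cons => /memv_addP[x xw [y ys ->]]; rewrite mulmxDr.
by apply: memv_add; [rewrite (weight_spaceP _ _ xw) rpredZ | apply: IH].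
Qed.

(** Weight vectors of distinct weights stay independent modulo W: if la and mu
differ at i, then H_i - mu_i removes the mu-part of v and multiplies the class
of v by the nonzero scalar la_i - mu_i. *)
Lemma weight_mod W la (s : seq 'rV[rat]_n) v :
  (forall i w, w \in W -> opH i *m w \in W) ->
  v \in (\sum_(mu <- s) weight_space M mu)%VS ->
  (forall i, opH i *m v - ratr (la 0 i) *: v \in W) ->
  la \notin s -> v \in W.
Proof.
move=> WH; elim: s v => [|mu s IH] v.
  by rewrite big_nil memv0 => /eqP -> _ _; rewrite mem0v.
rewrite big_cons inE negb_or => /memv_addP[u uw [v' v's ->]] hv /andP[nla las].
set v0 := u + v' in hv *.
have [i ni] : exists i, la 0 i != mu 0 i.
  apply/existsP; apply: contraNT nla => /existsPn e; apply/eqP/rowP => i.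
  by apply/eqP; have := e i; rewrite negbK.
set c := ratr (mu 0 i) : F.
have in_s : opH i *m v0 - c *: v0 \in (\sum_(mu <- s) weight_space M mu)%VS.
  rewrite mulmxDr scalerDr (weight_spaceP _ _ uw) opprD addrACA subrr add0r.
  by rewrite rpredB ?rpredZ ?weight_sum_stable.
have in_W : opH i *m v0 - c *: v0 \in W.
  apply: IH => // j.
  have -> : opH j *m (opH i *m v0 - c *: v0) - ratr (la 0 j) *: (opH i *m v0 - c *: v0) =
    opH i *m (opH j *m v0 - ratr (la 0 j) *: v0) - c *: (opH j *m v0 - ratr (la 0 j) *: v0).
    rewrite !mulmxBr -!scalemxAr (cartan_act_comm j i).
    move: (opH i *m (opH j *m v0)) (opH i *m v0) (opH j *m v0) => p q r.
    by apply/matrixP => k l; rewrite !mxE; ring.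
  by rewrite rpredB ?rpredZ ?WH.
have := rpredB in_W (hv i); rewrite opprB addrC addrA subrK -scalerBl rpredZeq.
case/orP => //; rewrite subr_eq0 => /eqP /(ratr_injective F_char0) e.
by rewrite e eqxx in ni.
Qed.

(** Repetitions in s are harmless: the sum of subspaces need not be direct. *)
Definition weights_span (s : seq 'rV[rat]_n) : Prop :=
  (\sum_(mu <- s) weight_space M mu)%VS = fullv.

Lemma submodule_cartan W : submodule W -> forall i w, w \in W -> opH i *m w \in W.
Proof. by move=> sW i w; apply: sW; apply: cartan_so. Qed.

(** If la were not a weight of M, removing it from s would not change the span, and
[weight_mod] would put the highest weight vector into W. *)
Lemma quotient_weight U W la s : weights_span s -> submodule W ->
  quotient_highest_weight U W la -> weight_space M la <> 0%VS /\ la \in s.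
Proof.
move=> sp sW [v [_ vW wt _]].
have notin s' : weights_span s' -> la \in s'.
  move=> sp'; apply: contraNT vW.
  by apply: weight_mod wt; [apply: submodule_cartan | rewrite sp' memvf].
split; last exact: notin.
move=> w0; suff /notin : weights_span [seq mu <- s | mu != la].
  by rewrite mem_filter eqxx.
rewrite /weights_span big_filter big_mkcond -sp; apply: eq_bigr => mu _.
by case: eqVneq => // ->.
Qed.

Lemma weight_in_span la s : weights_span s -> weight_space M la <> 0%VS -> la \in s.
Proof.
move=> sp w0; apply: contraT => las; case: w0; apply/eqP; rewrite -subv0.
apply/subvP => v vw; apply: weight_mod las => //.
- by move=> i w; rewrite !memv0 => /eqP ->; rewrite mulmx0.
- by rewrite sp memvf.
by move=> i; rewrite (weight_spaceP _ _ vw) subrr mem0v.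
Qed.

End Modules.

Section RootSpaces.
Variables (F : fieldType) (n : nat).
Hypothesis F_char0 : [pchar F] =i pred0.

Lemma vwt_x (i j : 'I_n) : vwt (lshift n i) j = (j == i :> nat)%:Z.
Proof. by rewrite /vwt eq_lshift eq_lrshift subr0 eq_sym. Qed.

Lemma vwt_y (i j : 'I_n) : vwt (rshift n i) j = - (j == i :> nat)%:Z.
Proof. by rewrite /vwt eq_rshift eq_rlshift sub0r eq_sym. Qed.

Lemma short_in_root_space (i : 'I_n) : i.+1 = n ->
  in_root_space (simple_root i) (short (xv F i)).
Proof.
move=> e; split=> [|j]; first exact: short_so.
by rewrite simple_rootE ratr_int cartan_sv vwt_x coord_last.
Qed.

Lemma long_in_root_space (i i' : 'I_n) : i.+1 = i' ->
  in_root_space (simple_root i) (lie_bracket (short (xv F i)) (short (yv F i'))).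
Proof.
move=> e; split=> [|j]; first exact: svsv_so.
by rewrite simple_rootE ratr_int cartan_svsv vwt_x vwt_y (coord_next _ e).
Qed.

(** Conversely, simple root spaces are lines: a property closed under linear
combinations holds on them as soon as it holds for the vectors above. *)
Lemma last_root_space (P : 'M[F]_(n + n + 1) -> Prop) (i : 'I_n) A :
  P 0 ->
  (forall k B C, B \in so F n -> C \in so F n -> P B -> P C -> P (k *: B + C)) ->
  i.+1 = n -> in_root_space (simple_root i) A -> P (short (xv F i)) -> P A.
Proof.
move=> P0 Pl e rt Px; apply: (root_space_ind F_char0 P0 Pl (@simple_rootE _ i) rt).
  move=> p h; move: (h i); rewrite coord_last //.
  case: (split_ordP p) h => k -> h; rewrite ?vwt_x ?vwt_y; last lia.
  by rewrite eqxx; case: (eqVneq (i : nat) k) => [/val_inj <-|].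
move=> p q h; have := h i; move: (h); case: (split_ordP p) => k ->;
  case: (split_ordP q) => l -> {}h; have := h k; have := h l;
  rewrite !coord_last // ?vwt_x ?vwt_y; lia.
Qed.

Lemma next_root_space (P : 'M[F]_(n + n + 1) -> Prop) (i i' : 'I_n) A :
  P 0 ->
  (forall k B C, B \in so F n -> C \in so F n -> P B -> P C -> P (k *: B + C)) ->
  i.+1 = i' -> in_root_space (simple_root i) A ->
  P (lie_bracket (short (xv F i)) (short (yv F i'))) -> P A.
Proof.
move=> P0 Pl e rt Pxy; apply: (root_space_ind F_char0 P0 Pl (@simple_rootE _ i) rt).
  move=> p h; have := h i; have := h i'; rewrite !(coord_next _ e).
  case: (split_ordP p) h => k -> _; rewrite ?vwt_x ?vwt_y; lia.
move=> p q h.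
have [[-> ->]|[-> ->]] : (p = lshift n i /\ q = rshift n i') \/
   (p = rshift n i' /\ q = lshift n i).
  have := h i; have := h i'; rewrite !(coord_next _ e).
  case: (split_ordP p) h => k ->; case: (split_ordP q) => l -> _;
    rewrite ?vwt_x ?vwt_y => h1 h2.
  - lia.
  - have [ek el] : i = k :> nat /\ i' = l :> nat by lia.
    by left; rewrite (val_inj ek) (val_inj el).
  - have [ek el] : i' = k :> nat /\ i = l :> nat by lia.
    by right; rewrite (val_inj ek) (val_inj el).
  - lia.
- rewrite bracketC -scaleN1r -[X in P X]addr0.
  by apply: Pl => //; [apply: svsv_so | apply: so0].
exact: Pxy.
Qed.

End RootSpaces.

Section Dominance.
Variables (F : fieldType) (n : nat).
Hypothesis F_char0 : [pchar F] =i pred0.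
Variable M : so_module F n.

Lemma bracket_HX (j i : 'I_n) :
  lie_bracket (opH M j) (opX M i) = (j == i)%:R *: opX M i.
Proof.
rewrite -mact_bracket ?cartan_so ?short_so // cartan_sv vwt_x -pmulrn.
by rewrite mactZ ?short_so.
Qed.

Lemma bracket_HY (j i : 'I_n) :
  lie_bracket (opH M j) (opY M i) = - (j == i)%:R *: opY M i.
Proof.
rewrite -mact_bracket ?cartan_so ?short_so // cartan_sv vwt_y rmorphN /= -pmulrn.
by rewrite mactZ ?short_so.
Qed.

Lemma bracket_XYX (i j k : 'I_n) :
  lie_bracket (lie_bracket (opX M i) (opY M j)) (opX M k) = - (j == k)%:R *: opX M i.
Proof. by rewrite mact_short3 bform_xx bform_yx scale0r sub0r scaleNr. Qed.

Lemma bracket_XYY (i j k : 'I_n) :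
  lie_bracket (lie_bracket (opX M i) (opY M j)) (opY M k) = (i == k)%:R *: opY M j.
Proof. by rewrite mact_short3 bform_xy bform_yy scale0r subr0. Qed.

(** The root vectors of eps_i - eps_j and of its opposite form an sl2-triple with
H_i - H_j. *)
Lemma long_triple (i j : 'I_n) : i != j ->
  lie_bracket (lie_bracket (opX M i) (opY M j)) (lie_bracket (opX M j) (opY M i)) = opH M i - opH M j /\
  lie_bracket (opH M i - opH M j) (lie_bracket (opX M j) (opY M i)) =
    (- 2%:R) *: lie_bracket (opX M j) (opY M i).
Proof.
move=> nij; split.
  rewrite jacobi bracket_XYX bracket_XYY !eqxx bracketZl bracketZr scaleN1r scale1r.
  by rewrite !bracket_XY opprK.
rewrite bracketBl !(bracket_wt (bracket_HX _ j) (bracket_HY _ i)) -scalerBl.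
rewrite !eqxx [j == i]eq_sym (negPf nij) mulr1n mulr0n; congr (_ *: _); ring.
Qed.

(** The weight la_i - la_(i+1), or 2 la_n, of the simple coroot is a natural number
by the theory of sl2. *)
Lemma quotient_weight_pairing (U W : {vspace 'cV[F]_(mdim M)}) la (i : 'I_n) :
  submodule W -> quotient_highest_weight U W la -> 0 <= pairing (simple_coroot i) la.
Proof.
move=> sW [v [_ vW wt hw]].
have hv j : opH M j *m v - ratr (la 0 j) *: v \in W by apply: wt.
have nat_ge0 (q : rat) : (exists k : nat, ratr q = k%:R :> F) -> 0 <= q.
  by case=> k; rewrite -(ratr_nat F k) => /(ratr_injective F_char0) ->; apply: Num.Theory.ler0n.
have Wm A : A \in so F n -> forall w, w \in W -> mact M A *m w \in W.
  by move=> sA w; apply: sW.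
have [e|lt] : i.+1 = n \/ (i.+1 < n)%N by have := ltn_ord i; lia.
  rewrite (pairing_last _ e); apply: nat_ge0.
  apply: (@sl2_weight_nat _ _ F_char0 (opX M i) (- 2%:R *: opY M i) (2%:R *: opH M i) W _ _ _ _ _ v).
  - by rewrite bracketZr bracket_XY scaleNr scalerN opprK.
  - by rewrite bracketZl bracketZr bracket_HY eqxx mulr1n !scalerA; congr (_ *: _); ring.
  - by apply: Wm; apply: short_so.
  - by move=> w wW; rewrite -scalemxAl rpredZ // Wm ?short_so.
  - by move=> w wW; rewrite -scalemxAl rpredZ // Wm ?cartan_so.
  - by [].
  - by apply: (hw i); apply: short_in_root_space.
  have -> : ratr (2%:R * la 0 i) = 2%:R * ratr (la 0 i) :> F.
    by rewrite !mulr_natl !mulr2n ratr_additive.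
  by rewrite -scalemxAl -scalerA -scalerBr rpredZ.
pose i' := Ordinal lt; have e : i.+1 = i' by [].
have ni : i != i' by rewrite -val_eqE /=; lia.
have [ef hf] := long_triple ni.
rewrite (pairing_next _ e); apply: nat_ge0.
apply: (sl2_weight_nat F_char0 ef hf (W := W) _ _ _ (v := v)) => //.
- by rewrite -mact_bracket ?short_so //; apply: Wm; apply: svsv_so.
- by rewrite -mact_bracket ?short_so //; apply: Wm; apply: svsv_so.
- by move=> w wW; rewrite mulmxBl rpredB ?Wm ?cartan_so.
- rewrite -mact_bracket ?short_so //; apply: (hw i); exact: long_in_root_space.
rewrite ratrB // scalerBl mulmxBl opprD opprK addrACA [- _ + _]addrC.
by rewrite rpredD // -opprB rpredN.
Qed.

End Dominance.

(** * Composition factors from singular vectors *)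

Section CompositionSeries.
Variables (F : fieldType) (n : nat).
Variable M : so_module F n.
Implicit Types (A B C U W N : {vspace 'cV[F]_(mdim M)}) (t : seq {vspace 'cV[F]_(mdim M)}).

(** A composition series from A to B, with A kept apart from the list so that
chains can be concatenated. *)
Definition simple_chain A t B : Prop :=
  last A t = B /\
  forall k, (k < size t)%N -> simple_quotient (nth 0%VS (A :: t) k.+1) (nth 0%VS (A :: t) k).

Lemma simple_chain_cat A B C t1 t2 :
  simple_chain A t1 B -> simple_chain B t2 C -> simple_chain A (t1 ++ t2) C.
Proof.
move=> [l1 c1] [l2 c2]; split; first by rewrite last_cat l1.
move=> k; rewrite size_cat => lk.
have [lk1|gk1] := ltnP k (size t1).
  have := c1 k lk1; rewrite -!cat_cons !nth_cat /= !ltnS lk1 (ltnW lk1).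
  by case: k {lk lk1} => [|k].
have e j : nth 0%VS (A :: t1 ++ t2) (size t1 + j) = nth 0%VS (B :: t2) j.
  case: j => [|j]; last by rewrite addnS /= nth_cat ltnNge leq_addr /= addKn.
  rewrite addn0 /= -l1 -cat_cons nth_cat /= ltnSn.
  by rewrite -[size t1]/((size (A :: t1)).-1) nth_last.
rewrite -(subnKC gk1) -addnS !e; apply: c2.
by rewrite ltn_subLR.
Qed.

(** Refine as long as a submodule lies strictly in between. *)
Lemma simple_chain_exists A B : submodule A -> submodule B -> (A <= B)%VS ->
  exists t, simple_chain A t B.
Proof.
have [m] := ubnP (\dim B - \dim A)%N; elim: m A B => // m IH A B lm sA sB AB.
have [->|nAB] := eqVneq A B; first by exists [::].
have [[N [sN AN NB [nNA nNB]]]|no] :=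
  classic (exists N, [/\ submodule N, (A <= N)%VS, (N <= B)%VS & N <> A /\ N <> B]).
  have lt1 : (\dim A < \dim N)%N.
    rewrite (ltn_leqif (dimv_leqif_eq AN)); apply/eqP => e; exact: nNA.
  have lt2 : (\dim N < \dim B)%N.
    rewrite (ltn_leqif (dimv_leqif_eq NB)); apply/eqP => e; exact: nNB.
  have [t1 c1] : exists t, simple_chain A t N by apply: IH => //; move: lm lt1 lt2; lia.
  have [t2 c2] : exists t, simple_chain N t B by apply: IH => //; move: lm lt1 lt2; lia.
  by exists (t1 ++ t2); apply: simple_chain_cat c1 c2.
exists [:: B]; split=> // -[|//] _ /=; split=> // N sN AN NB.
have [->|/eqP nNA] := eqVneq N A; first by left.
have [->|/eqP nNB] := eqVneq N B; first by right.
by case: no; exists N.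
Qed.

Lemma composition_series_through U W : simple_quotient U W ->
  exists s k, [/\ composition_series s, (k.+1 < size s)%N,
    nth 0%VS s k.+1 = U & nth 0%VS s k = W].
Proof.
move=> sq; have [sU sW WU _ _] := sq.
have [t1 [l1 c1]] := simple_chain_exists (@submodule0 _ _ M) sW (sub0v _).
have [t2 c2] := simple_chain_exists sU (@submodulef _ _ M) (subvf _).
have c3 : simple_chain W (U :: t2) fullv.
  by apply: (@simple_chain_cat _ _ _ [:: U]) c2; split=> // -[].
have [l c] := simple_chain_cat (conj l1 c1) c3.
exists (0%VS :: t1 ++ U :: t2), (size t1); split.
- by split=> //= k; rewrite ltnS; apply: c.
- by rewrite /= size_cat /=; lia.
- by rewrite /= nth_cat ltnn subnn.
by rewrite -cat_cons nth_cat /= ltnSn -[size t1]/((size (0%VS :: t1)).-1) nth_last.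
Qed.

(** A singular vector v gives a composition factor of its weight: take U minimal
among the submodules containing v, and W maximal among the submodules of U that
do not contain v. *)
Lemma highest_weight_factor la :
  has_highest_weight M la -> composition_factor_highest_weight M la.
Proof.
case=> v [_ v0 wt hw].
have [U [sU vU] minU] : exists2 U, submodule U /\ v \in U &
    forall N, submodule N -> v \in N -> (N <= U)%VS -> N = U.
  suff min m U : (\dim U <= m)%N -> submodule U /\ v \in U ->
      exists2 U, submodule U /\ v \in U &
        forall N, submodule N -> v \in N -> (N <= U)%VS -> N = U.
    by apply: (min _ _ (leqnn _)); split; [apply: submodulef | apply: memvf].
  elim: m U => [|m IH] U lm [sU vU].
    exists U => // N _ vN NU; apply/eqP; rewrite -(dimv_leqif_eq NU).
    by move: (dimvS NU) lm; lia.
  have [[N [sN vN NU nN]]|no] :=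
    classic (exists N, [/\ submodule N, v \in N, (N <= U)%VS & N <> U]).
    apply: (IH N) => //; rewrite -ltnS; apply: leq_trans lm.
    by rewrite (ltn_leqif (dimv_leqif_eq NU)); apply/eqP.
  exists U => // N sN vN NU; apply: NNPP => nN; apply: no; by exists N.
have [W [sW vW WU] maxW] : exists2 W, [/\ submodule W, v \notin W & (W <= U)%VS] &
    forall N, submodule N -> v \notin N -> (N <= U)%VS -> (W <= N)%VS -> N = W.
  suff max m W : (\dim U - \dim W <= m)%N ->
      [/\ submodule W, v \notin W & (W <= U)%VS] ->
      exists2 W, [/\ submodule W, v \notin W & (W <= U)%VS] &
      forall N, submodule N -> v \notin N -> (N <= U)%VS -> (W <= N)%VS -> N = W.
    by apply: (max _ 0%VS (leqnn _)); split=> //; [apply: submodule0 | apply: sub0v].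
  elim: m W => [|m IH] W lm [sW vW WU].
    exists W => // N _ _ NU WN; apply/esym/eqP; rewrite -(dimv_leqif_eq WN).
    by move: (dimvS WN) (dimvS NU) lm; lia.
  have [[N [sN vN NU WN nN]]|no] :=
    classic (exists N, [/\ submodule N, v \notin N, (N <= U)%VS, (W <= N)%VS & N <> W]).
    apply: (IH N) => //.
    have : (\dim W < \dim N)%N.
      by rewrite (ltn_leqif (dimv_leqif_eq WN)); apply/eqP => e; apply: nN.
    by move: (dimvS NU) lm; lia.
  exists W => // N sN vN NU WN; apply: NNPP => nN; apply: no; by exists N.
have sq : simple_quotient U W.
  split=> //; first by apply: contraNneq vW => ->.
  move=> N sN WN NU; have [vN|vN] := boolP (v \in N).
    by right; apply: minU.
  by left; apply: maxW.
have [s [k [cs lk eU eW]]] := composition_series_through sq.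
exists s, k; split=> //; rewrite eU eW; exists v; split=> //.
- by move=> i; move: (wt i); rewrite memv0 => /eqP ->; apply: mem0v.
- by move=> i A rA; move: (hw i A rA); rewrite memv0 => /eqP ->; apply: mem0v.
Qed.

End CompositionSeries.

(** * Clifford relations on the spin module *)

Section Clifford.
Variables (F : fieldType) (n : nat).
Hypothesis F_char0 : [pchar F] =i pred0.
Variable M : so_module F n.
Local Notation X := (opX M).
Local Notation Y := (opY M).
Local Notation H := (opH M).
Implicit Types (i j : 'I_n) (p q s : 'I_(n + n)) (v m : 'cV[F]_(mdim M)).

Definition clifford_defect p q : 'M[F]_(mdim M) :=
  mact M (sv F p) *m mact M (sv F q) + mact M (sv F q) *m mact M (sv F p)
  + (2%:R^-1 * gram F n p q)%:M.

Lemma clifford_defectE p q v : clifford_defect p q *m v =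
  mact M (sv F p) *m (mact M (sv F q) *m v) + mact M (sv F q) *m (mact M (sv F p) *m v)
  + (2%:R^-1 * gram F n p q) *: v.
Proof. by rewrite !mulmxDl mul_scalar_mx -!mulmxA. Qed.

Lemma gram_sym p q : gram F n p q = gram F n q p.
Proof. by rewrite -[in LHS]gram_tr mxE. Qed.

Lemma mact_sv3 p q s v :
  mact M (sv F p) *m (mact M (sv F q) *m (mact M (sv F s) *m v))
  - mact M (sv F q) *m (mact M (sv F p) *m (mact M (sv F s) *m v))
  - (mact M (sv F s) *m (mact M (sv F p) *m (mact M (sv F q) *m v))
     - mact M (sv F s) *m (mact M (sv F q) *m (mact M (sv F p) *m v)))
  = gram F n p s *: (mact M (sv F q) *m v) - gram F n q s *: (mact M (sv F p) *m v).
Proof.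
have := mact_short3 M (delta_mx p 0) (delta_mx q 0) (delta_mx s 0).
rewrite !bform_delta => /(congr1 (fun A => A *m v)).
rewrite [in RHS]mulmxBl -!scalemxAl /lie_bracket => <-.
by rewrite !mulmxBl !mulmxBr !mulmxBl -!mulmxA.
Qed.

(** The vectors on which the short root vectors satisfy the Clifford relations form
a submodule: by the bracket relations, the defect of the triple p, q, s satisfies a
linear system whose only solution, up to a factor 3, is zero. *)
Lemma clifford_stable m s : (forall p q, clifford_defect p q *m m = 0) ->
  forall p q, clifford_defect p q *m (mact M (sv F s) *m m) = 0.
Proof.
move=> hm p q.
(* The relations on m exchange the last two factors of a product of three. *)
have h1 a b c : mact M (sv F a) *m (mact M (sv F b) *m (mact M (sv F c) *m m)) =
   - (mact M (sv F a) *m (mact M (sv F c) *m (mact M (sv F b) *m m)))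
   - (2%:R^-1 * gram F n b c) *: (mact M (sv F a) *m m).
  have /(congr1 (fun w => mact M (sv F a) *m w)) := hm b c.
  rewrite clifford_defectE mulmx0 !mulmxDr -scalemxAr => /eqP.
  by rewrite -addrA addr_eq0 => /eqP ->; rewrite opprD.
have e1 := mact_sv3 p q s m; have e2 := mact_sv3 p s q m.
rewrite clifford_defectE.
rewrite (h1 s q p) ?(gram_sym q p) in e1.
rewrite (h1 p s q) (h1 q s p) (gram_sym s q) (gram_sym s p) in e2.
move: (mact M (sv F p) *m m) (mact M (sv F q) *m m) (mact M (sv F s) *m m)
  (mact M (sv F p) *m (mact M (sv F q) *m (mact M (sv F s) *m m)))
  (mact M (sv F q) *m (mact M (sv F p) *m (mact M (sv F s) *m m)))
  (mact M (sv F s) *m (mact M (sv F p) *m (mact M (sv F q) *m m)))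
  e1 e2 => u1 u2 u3 T1 T2 T3 e1 e2.
apply/matrixP => i j; move/matrixP/(_ i j): e1; move/matrixP/(_ i j): e2.
rewrite !mxE; move: (u1 i j) (u2 i j) (u3 i j) (T1 i j) (T2 i j) (T3 i j)
  => x1 x2 x3 t1 t2 t3 /eqP; rewrite -subr_eq0 => /eqP e2 /eqP; rewrite -subr_eq0 => /eqP e1.
have three : 3%:R != 0 :> F by rewrite natf_eq0.
apply: (mulfI three); rewrite mulr0.
(* Three times the claim is the first relation minus twice the second. *)
have := congr2 (fun x y => x - 2%:R * y) e1 e2; rewrite mulr0 subrr => <-.
by field; rewrite two_neq0.
Qed.

(** Hence the Clifford relations on S follow from those on its highest weight
vector. *)
Lemma clifford_irreducible v : irreducible M -> v != 0 ->
  (forall p q, clifford_defect p q *m v = 0) -> forall p q, clifford_defect p q = 0.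
Proof.
move=> [_ _ _ _ irr] v0 hv p q.
pose K := (\bigcap_(u : 'I_(n + n) * 'I_(n + n))
  lker (linfun (mulmx (clifford_defect u.1 u.2) : 'cV[F]_(mdim M) -> _)))%VS.
have KP m : m \in K <-> forall p q, clifford_defect p q *m m = 0.
  rewrite memvE; split=> [/subv_bigcapP h a b|h].
    by have := h (a, b) isT; rewrite -memvE memv_ker lfunE /= => /eqP.
  by apply/subv_bigcapP => -[a b] _; rewrite -memvE memv_ker lfunE /= h.
have [|K0|Kf] := irr K _ (sub0v _) (subvf _).
- by apply: submodule_short => // s m /KP hm; apply/KP; apply: clifford_stable.
- by move: v0; rewrite -memv0 -K0; move/negP; case; apply/KP.
apply/matrixP => i j; have /KP/(_ p q) : delta_mx j 0 \in K by rewrite Kf memvf.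
by rewrite -colE => /matrixP/(_ i 0); rewrite !mxE.
Qed.

End Clifford.

Section SpinHighestWeight.
Variables (F : fieldType) (n : nat).
Hypothesis F_char0 : [pchar F] =i pred0.
Variable M : so_module F n.
Local Notation X := (opX M).
Local Notation Y := (opY M).
Local Notation H := (opH M).
Implicit Types (i j : 'I_n).
Variable v : 'cV[F]_(mdim M).
Hypothesis Hv : forall i, H i *m v = 2%:R^-1 *: v.
Hypothesis Xv_last : forall i, i.+1 = n -> X i *m v = 0.
Hypothesis XYv_next : forall i i', i.+1 = i' :> nat -> lie_bracket (X i) (Y i') *m v = 0.

(** The highest weight vector is killed by all positive root vectors, as these are
brackets of the simple ones. *)
Lemma positive_kill m i : (n <= i + m)%N ->
  X i *m v = 0 /\ forall j, (i < j)%N -> X i *m (Y j *m v) = 0.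
Proof.
elim: m i => [|m IH] i; first by have := ltn_ord i; lia.
move=> le_n; have [e|lt] : i.+1 = n \/ (i.+1 < n)%N by have := ltn_ord i; lia.
  by split=> [|j]; [apply: Xv_last | have := ltn_ord j; lia].
pose i' := Ordinal lt; have [|X'v X'Yv] := IH i'; first by rewrite /=; lia.
set E := lie_bracket (X i) (Y i').
have Ev : E *m v = 0 by apply: XYv_next.
have Xi : X i = - lie_bracket E (X i').
  by rewrite bracket_XYX eqxx mulr1n scaleN1r opprK.
have Xv : X i *m v = 0.
  by rewrite Xi mulNmx /lie_bracket mulmxBl -!mulmxA X'v Ev !mulmx0 subr0 oppr0.
split=> // j lt_ij; have [->|nj] := eqVneq j i'.
  by rewrite bracket_mulmx Xv mulmx0 add0r.
have lt_ij' : (i' < j)%N.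
  by rewrite ltn_neqAle lt_ij eq_sym; move: nj; rewrite -val_eqE => ->.
have EYv : E *m (Y j *m v) = 0.
  rewrite bracket_mulmx Ev mulmx0 add0r bracket_XYY.
  by rewrite -val_eqE ltn_eqF //= mulr0n scale0r mul0mx.
by rewrite Xi mulNmx /lie_bracket mulmxBl -!mulmxA X'Yv // EYv !mulmx0 subr0 oppr0.
Qed.

Lemma Xv i : X i *m v = 0.
Proof. by have [] := @positive_kill n i (leq_addl _ _). Qed.

(** For i > j this is a negative root vector, and sl2-theory applies because the
coroot of eps_j - eps_i vanishes on the spin weight. *)
Lemma bracket_XYv i j : i != j -> lie_bracket (X i) (Y j) *m v = 0.
Proof.
have pos (a b : 'I_n) : (a < b)%N -> lie_bracket (X a) (Y b) *m v = 0.
  move=> lt; have [Xav XYav] := @positive_kill n a (leq_addl _ _).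
  by have := XYav b lt; rewrite bracket_mulmx Xav mulmx0 add0r.
move=> nij; have [lt|gt|e] := ltngtP i j; first exact: pos.
  rewrite eq_sym in nij; have [ef hf] := long_triple M nij.
  apply: (sl2_string_zero F_char0 (k := 0) ef hf); first exact: pos.
  by rewrite mulmxBl !Hv subrr scale0r.
by move: nij; rewrite -val_eqE /= e eqxx.
Qed.

(** The coroot 2 H_i takes the value 1 on the spin weight, so the string of v under
Y_i has length 2. *)
Lemma YYv_diag i : Y i *m (Y i *m v) = 0.
Proof.
have /= : iter 2 (mulmx (- 2%:R *: Y i)) v = 0.
  apply: (@sl2_string_zero _ _ F_char0 (X i) _ (2%:R *: H i)); last first.
  - by rewrite -scalemxAl Hv scalerA mulfV ?two_neq0.
  - exact: Xv.
  - by rewrite bracketZl bracketZr bracket_HY eqxx mulr1n !scalerA; congr (_ *: _); ring.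
  - by rewrite bracketZr bracket_XY scaleNr scalerN opprK.
rewrite -!scalemxAl -scalemxAr scalerA => /eqP; rewrite scaler_eq0 mulf_eq0 oppr_eq0.
by rewrite (negPf (two_neq0 F_char0)) => /eqP.
Qed.

(** Polarise Y_j ^ 2 v = 0 with the root vector [X_j, Y_i], which kills v and sends
Y_j to Y_i. *)
Lemma YYv i j : Y i *m (Y j *m v) + Y j *m (Y i *m v) = 0.
Proof.
have [->|nij] := eqVneq i j; first by rewrite YYv_diag addr0.
set E := lie_bracket (X j) (Y i).
have Ev : E *m v = 0 by apply: bracket_XYv; rewrite eq_sym.
have EY (w : 'cV[F]_(mdim M)) : E *m (Y j *m w) = Y j *m (E *m w) + Y i *m w.
  by rewrite bracket_mulmx bracket_XYY eqxx mulr1n scale1r.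
have /(congr1 (mulmx E)) := YYv_diag j.
by rewrite mulmx0 !EY Ev mulmx0 add0r addrC.
Qed.

Lemma XYv i j : X i *m (Y j *m v) + Y j *m (X i *m v) = - (2%:R^-1 * (i == j)%:R) *: v.
Proof.
rewrite Xv mulmx0 addr0 bracket_mulmx Xv mulmx0 add0r.
have [<-|nij] := eqVneq i j; first by rewrite bracket_XY mulNmx Hv mulr1n mulr1 scaleNr.
by rewrite bracket_XYv // mulr0n mulr0 oppr0 scale0r.
Qed.

Lemma clifford_defect_hwv p q : clifford_defect M p q *m v = 0.
Proof.
rewrite clifford_defectE /gram.
case: (split_ordP p) => i ->; case: (split_ordP q) => j ->.
- by rewrite block_mxEul mxE mulr0 scale0r -!/(X _) !Xv !mulmx0 !addr0.
- rewrite block_mxEur mxE -/(X i) -/(Y j) XYv -scalerDl addNr scale0r //.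
- rewrite block_mxEdl mxE -/(X j) -/(Y i) [X in X + _ *: _]addrC XYv eq_sym.
  by rewrite -scalerDl addNr scale0r.
- by rewrite block_mxEdr mxE mulr0 scale0r addr0; apply: YYv.
Qed.

End SpinHighestWeight.

Section CAR.
Variables (F : fieldType) (n N : nat).
Implicit Types (a b : 'I_n -> 'M[F]_N) (w : 'cV[F]_N).

(** The canonical anticommutation relations of n fermions, with annihilators a
and creators b. *)
Definition car a b : Prop := forall i j,
  [/\ a i *m a j + a j *m a i = 0, b i *m b j + b j *m b i = 0 &
      a i *m b j + b j *m a i = (i == j)%:R%:M].

End CAR.

Section SpinCAR.
Variables (F : fieldType) (n : nat).
Hypothesis F_char0 : [pchar F] =i pred0.
Variable M : so_module F n.
Hypothesis M_irr : irreducible M.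
Hypothesis M_spin : has_highest_weight M (spin_weight n).

Lemma spin_weightE i : spin_weight n 0 i = 2%:R^-1.
Proof.
rewrite mxE summxE (bigD1 i) //= epsE eqxx big1 ?addr0 ?mulr1 // => j nj.
by rewrite epsE -[_ == _ :> nat]/(i == j) eq_sym (negPf nj).
Qed.

Lemma ratr_spin_weight i : ratr (spin_weight n 0 i) = 2%:R^-1 :> F.
Proof. by have := ratr_half F_char0 1; rewrite spin_weightE !mul1r. Qed.

Lemma spin_car : car (opX M) (fun i => - 2%:R *: opY M i).
Proof.
have [v [_ v0 wt hw]] := M_spin.
have cl p q : clifford_defect M p q = 0.
  apply: (clifford_irreducible F_char0 M_irr (v := v)); first by rewrite -memv0.
  apply: clifford_defect_hwv => // [i|i e|i i' e].
  - by apply/eqP; have := wt i; rewrite ratr_spin_weight memv0 subr_eq0.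
  - by apply/eqP; rewrite -memv0; apply: (hw i); apply: short_in_root_space.
  - rewrite -mact_bracket ?short_so //; apply/eqP; rewrite -memv0.
    by apply: (hw i); apply: long_in_root_space.
move=> i j; split.
- have := cl (lshift n i) (lshift n j).
  by rewrite /clifford_defect /gram block_mxEul mxE mulr0 raddf0 addr0.
- have := cl (rshift n i) (rshift n j).
  rewrite /clifford_defect /gram block_mxEdr mxE mulr0 raddf0 addr0 => e.
  by rewrite -!scalemxAl -!scalemxAr -!scalerDr e !scaler0.
have := cl (lshift n i) (rshift n j).
rewrite /clifford_defect /gram block_mxEur mxE => /eqP; rewrite addr_eq0 => /eqP e.
rewrite -scalemxAl -scalemxAr -scalerDr e scalerN scaleNr opprK scale_scalar_mx.
by rewrite mulrA mulfV ?two_neq0 // mul1r.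
Qed.

End SpinCAR.

(** * Pairing two systems of fermions *)

Section Fermions.
Variables (F : fieldType) (n N : nat).
Implicit Types (a b : 'I_n -> 'M[F]_N) (w : 'cV[F]_N) (A B C T G : 'M[F]_N).

Definition anti A B : Prop := A *m B = - (B *m A).

Lemma comm_mulmx A B w : comm_mx A B -> A *m (B *m w) = B *m (A *m w).
Proof. by move=> e; rewrite !mulmxA e. Qed.

Lemma anti_mulmx A B w : anti A B -> A *m (B *m w) = - (B *m (A *m w)).
Proof. by move=> e; rewrite !mulmxA e mulNmx. Qed.

Lemma anti_sym A B : anti A B -> anti B A.
Proof. by rewrite /anti => ->; rewrite opprK. Qed.

Lemma comm_anti_mul A B C : anti A B -> anti A C -> comm_mx A (B *m C).
Proof.
by move=> eB eC; rewrite /comm_mx mulmxA eB mulNmx -(mulmxA B A C) eC mulmxN opprK mulmxA.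
Qed.

Lemma anti_mulr A B C : anti A B -> comm_mx A C -> anti A (B *m C).
Proof. by move=> eB eC; rewrite /anti mulmxA eB mulNmx -(mulmxA B A C) eC mulmxA. Qed.

Lemma anti_mull A B C : comm_mx A B -> anti A C -> anti A (B *m C).
Proof. by move=> eB eC; rewrite /anti mulmxA eB -(mulmxA B A C) eC mulmxN mulmxA. Qed.

(** It is 1 or - 1 according to whether the i-th mode is empty or occupied. *)
Definition parity a b i := a i *m b i - b i *m a i.

Section Parity.
Variables a b : 'I_n -> 'M[F]_N.
Hypothesis char2 : 2%:R != 0 :> F.
Hypothesis ab : car a b.

Lemma car_aa i j : anti (a i) (a j).
Proof. by have [e _ _] := ab i j; apply/eqP; rewrite -addr_eq0 e. Qed.

Lemma car_bb i j : anti (b i) (b j).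
Proof. by have [_ e _] := ab i j; apply/eqP; rewrite -addr_eq0 e. Qed.

Lemma car_ab i j : i != j -> anti (a i) (b j).
Proof.
move=> nij; have [_ _ e] := ab i j; apply/eqP; rewrite -addr_eq0 e.
by rewrite (negPf nij) raddf0.
Qed.

Lemma anti_self A : anti A A -> A *m A = 0.
Proof.
rewrite /anti => /eqP; rewrite -addr_eq0 -mulr2n -scaler_nat scaler_eq0.
by rewrite (negPf char2) => /eqP.
Qed.

Lemma car_aa0 i : a i *m a i = 0. Proof. exact/anti_self/car_aa. Qed.
Lemma car_bb0 i : b i *m b i = 0. Proof. exact/anti_self/car_bb. Qed.

Lemma car_ab_diag i : a i *m b i = 1%:M - b i *m a i.
Proof. by have [_ _] := ab i i; rewrite eqxx => <-; rewrite addrK. Qed.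

Lemma parityE i : parity a b i = 1%:M - 2%:R *: (b i *m a i).
Proof. by rewrite /parity car_ab_diag scaler_nat mulr2n opprD addrA. Qed.

Lemma parity_kill i w : a i *m w = 0 -> parity a b i *m w = w.
Proof.
by move=> e; rewrite parityE mulmxBl mul1mx -scalemxAl -mulmxA e mulmx0 scaler0 subr0.
Qed.

Lemma parity_aC i : anti (parity a b i) (a i).
Proof.
rewrite /anti /parity mulmxBl mulmxBr.
by rewrite -[b i *m a i *m a i]mulmxA car_aa0 mulmx0 !mulmxA car_aa0 mul0mx subr0 sub0r opprK.
Qed.

Lemma parity_bC i : anti (parity a b i) (b i).
Proof.
rewrite /anti /parity mulmxBl mulmxBr.
by rewrite -[a i *m b i *m b i]mulmxA car_bb0 mulmx0 !mulmxA car_bb0 mul0mx subr0 sub0r.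
Qed.

Lemma parity_ne i j : i != j ->
  comm_mx (parity a b i) (a j) /\ comm_mx (parity a b i) (b j).
Proof.
move=> nij; have nji : j != i by rewrite eq_sym.
have aj1 := car_aa j i; have aj2 := car_ab nji.
have bj1 := anti_sym (car_ab nij); have bj2 := car_bb j i.
split; apply: comm_mx_sym; apply: comm_mxB; exact: comm_anti_mul.
Qed.

Lemma parity_sq i : parity a b i *m parity a b i = 1%:M.
Proof.
have qq : b i *m a i *m (b i *m a i) = b i *m a i.
  rewrite mulmxA -(mulmxA (b i)) car_ab_diag mulmxBr mulmx1 mulmxBl.
  by rewrite mulmxA car_bb0 !mul0mx subr0.
rewrite parityE; move: (b i *m a i) qq => q qq.
rewrite mulmxBl mul1mx mulmxBr mulmx1 -scalemxAl -scalemxAr qq.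
by move: (1%:M) => I; apply/matrixP => j k; rewrite !mxE; ring.
Qed.

(** The properties of the product of the parities of the modes from k on. *)
Definition twist k G : Prop :=
  [/\ G *m G = 1%:M,
      forall i : 'I_n, (i < k)%N -> comm_mx G (a i) /\ comm_mx G (b i),
      forall i : 'I_n, (k <= i)%N -> anti G (a i) /\ anti G (b i) &
      forall T, (forall i, comm_mx T (a i)) -> (forall i, comm_mx T (b i)) -> comm_mx T G].

Lemma twist_top : twist n 1%:M.
Proof.
split; first exact: mulmx1.
- by move=> i _; split; apply: comm_mx_sym; apply: comm_mx1.
- by move=> i; rewrite leqNgt ltn_ord.
- by move=> T _ _; apply: comm_mx1.
Qed.

Lemma comm_parity T i : comm_mx T (a i) -> comm_mx T (b i) -> comm_mx T (parity a b i).
Proof. by move=> ea eb; apply: comm_mxB; apply: comm_mxM. Qed.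

Lemma twist_step (k : 'I_n) G : twist k.+1 G -> twist k (G *m parity a b k).
Proof.
move=> [sq lo hi cT].
have [Ga Gb] := lo k (leqnn _).
have GZ := comm_parity Ga Gb.
split.
- by rewrite mulmxA -(mulmxA G) -GZ mulmxA sq mul1mx parity_sq.
- move=> i lt; have [Gai Gbi] := lo i (ltnW lt).
  have nki : k != i by rewrite -val_eqE gtn_eqF.
  have [Za Zb] := parity_ne nki.
  by split; apply: comm_mx_sym; apply: comm_mxM; apply: comm_mx_sym.
- move=> i; rewrite leq_eqVlt => /orP[/eqP/val_inj <-|lt].
    by split; apply: anti_sym; apply: anti_mull; rewrite ?(comm_mx_sym Ga) ?(comm_mx_sym Gb) //;
      apply: anti_sym; [apply: parity_aC | apply: parity_bC].
  have [Gai Gbi] := hi i lt.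
  have nki : k != i by rewrite -val_eqE ltn_eqF.
  have [Za Zb] := parity_ne nki.
  by split; apply: anti_sym; apply: anti_mulr; (apply: anti_sym || apply: comm_mx_sym).
- by move=> T Ta Tb; apply: comm_mxM; [apply: cT | apply: comm_parity].
Qed.

End Parity.

Section Pairing.
Variables a b a' b' : 'I_n -> 'M[F]_N.
Hypothesis char2 : 2%:R != 0 :> F.
Hypothesis ab : car a b.
Hypothesis ab' : car a' b'.
Hypothesis cc : forall i j, [/\ comm_mx (a i) (a' j), comm_mx (a i) (b' j),
  comm_mx (b i) (a' j) & comm_mx (b i) (b' j)].
Variable v : 'cV[F]_N.
Hypothesis v0 : v != 0.
Hypothesis av : forall i, a i *m v = 0.
Hypothesis av' : forall i, a' i *m v = 0.

Definition commutant T : Prop := forall i,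
  [/\ comm_mx T (a i), comm_mx T (b i), comm_mx T (a' i) & comm_mx T (b' i)].

(** From the vacuum of both copies, the modes from k on are paired off one by one.
Applying b_k + b'_k directly would not respect the modes already paired, since
b_k anticommutes with them; composing with the parity G of these modes, and with
the opposite relative sign, repairs this. *)
Lemma fermion_pairing_twist m k : (k + m)%N = n ->
  exists (W : 'cV[F]_N) (G G' : 'M[F]_N) (s : F),
  [/\ [/\ W != 0, twist a b k G, twist a' b' k G' & G *m W = s *: (G' *m W)],
      forall i : 'I_n, (i < k)%N -> a i *m W = 0 /\ a' i *m W = 0,
      forall i : 'I_n, (k <= i)%N ->
        a i *m W = - (a' i *m W) /\ b i *m W = - (b' i *m W) &
      forall T c, commutant T -> T *m v = c *: v -> T *m W = c *: W].
Proof.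
elim: m k => [|m IH] k.
  rewrite addn0 => ->; exists v, 1%:M, 1%:M, 1; split=> //.
  - by split=> //; [apply: twist_top | apply: twist_top | rewrite scale1r].
  - by move=> i; rewrite leqNgt ltn_ord.
rewrite addnS -addSn => e; have lt : (k < n)%N by move: e; lia.
have [W [G [G' [s [[W0 tG tG' GW] lo hi cT]]]]] := IH _ e.
pose q := Ordinal lt.
have [aW aW'] := lo q (leqnn _).
have [sq loG hiG cG] := tG; have [sq' loG' hiG' cG'] := tG'.
have aG' i : comm_mx (a i) G' by apply: cG' => j; have [] := cc i j.
have bG' i : comm_mx (b i) G' by apply: cG' => j; have [] := cc i j.
have a'G i : comm_mx (a' i) G by apply: cG => j; apply: comm_mx_sym; have [] := cc j i.
have b'G i : comm_mx (b' i) G by apply: cG => j; apply: comm_mx_sym; have [] := cc j i.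
have GG' : comm_mx G G' by apply: cG' => j; apply: comm_mx_sym.
have [Ga Gb] := loG q (leqnn _); have [Ga' Gb'] := loG' q (leqnn _).
set U := b q *m (G *m W); set U' := b' q *m (G' *m W).
have aqU : a q *m U = G *m W.
  rewrite /U mulmxA car_ab_diag // mulmxBl mul1mx -mulmxA.
  by rewrite -(comm_mulmx _ Ga) aW !mulmx0 subr0.
have aqU' : a' q *m U' = G' *m W.
  rewrite /U' mulmxA car_ab_diag // mulmxBl mul1mx -mulmxA.
  by rewrite -(comm_mulmx _ Ga') aW' !mulmx0 subr0.
have commU T : comm_mx T (b q) -> comm_mx T G -> T *m U = b q *m (G *m (T *m W)).
  by move=> e1 e2; rewrite /U (comm_mulmx _ e1) (comm_mulmx _ e2).
have commU' T : comm_mx T (b' q) -> comm_mx T G' -> T *m U' = b' q *m (G' *m (T *m W)).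
  by move=> e1 e2; rewrite /U' (comm_mulmx _ e1) (comm_mulmx _ e2).
have aU' i : a i *m U' = b' q *m (G' *m (a i *m W)).
  by apply: commU' => //; have [] := cc i q.
have bU' i : b i *m U' = b' q *m (G' *m (b i *m W)).
  by apply: commU' => //; have [] := cc i q.
have a'U i : a' i *m U = b q *m (G *m (a' i *m W)).
  by apply: commU => //; apply: comm_mx_sym; have [] := cc q i.
have b'U i : b' i *m U = b q *m (G *m (b' i *m W)).
  by apply: commU => //; apply: comm_mx_sym; have [] := cc q i.
exists (U - s *: U'), (G *m parity a b q), (G' *m parity a' b' q), (- s).
split.
- split; try exact: twist_step.
    apply/eqP => /(congr1 (mulmx (a q))).
    rewrite mulmx0 mulmxBr -scalemxAr aqU aU' aW !mulmx0 scaler0 subr0.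
    move/(congr1 (mulmx G)); rewrite mulmx0 mulmxA sq mul1mx => W00.
    by rewrite W00 eqxx in W0.
  have Z'U : parity a' b' q *m U = U.
    by apply: parity_kill => //; rewrite a'U aW' !mulmx0.
  have ZU' : parity a b q *m U' = U'.
    by apply: parity_kill => //; rewrite aU' aW !mulmx0.
  have ZU : parity a b q *m U = - U.
    rewrite /U (anti_mulmx _ (parity_bC char2 ab q)); congr (- (_ *m _)).
    rewrite -(comm_mulmx _ (comm_parity Ga Gb)).
    by rewrite parity_kill.
  have Z'U' : parity a' b' q *m U' = - U'.
    rewrite /U' (anti_mulmx _ (parity_bC char2 ab' q)); congr (- (_ *m _)).
    rewrite -(comm_mulmx _ (comm_parity Ga' Gb')).
    by rewrite parity_kill.
  rewrite -!mulmxA !mulmxBr -!scalemxAr ZU ZU' Z'U Z'U'.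
  (* G *m W = s *: (G' *m W) passes to U and U', hence to U - s *: U'. *)
  have GU : G *m U = s *: (G' *m U).
    by rewrite commU // (commU _ (comm_mx_sym (bG' q)) (comm_mx_sym GG')) GW -!scalemxAr.
  have GU' : G *m U' = s *: (G' *m U').
    by rewrite (commU' _ (comm_mx_sym (b'G q)) GG') commU' // GW -!scalemxAr.
  rewrite !mulmxN GU GU'; move: (G' *m U) (G' *m U') => x y.
  by apply/matrixP => i j; rewrite !mxE; ring.
- move=> i lti; have nqi : i != q by rewrite -val_eqE /= ltn_eqF.
  have [aiW aiW'] := lo i (ltnW lti).
  have [Gai _] := loG i (ltnW lti); have [Gai' _] := loG' i (ltnW lti).
  rewrite !mulmxBr -!scalemxAr aU' a'U aiW aiW' /U /U'.
  rewrite (anti_mulmx _ (car_ab ab nqi)) (anti_mulmx _ (car_ab ab' nqi)).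
  rewrite -(comm_mulmx _ Gai) -(comm_mulmx _ Gai') aiW aiW'.
  by rewrite !mulmx0 oppr0 scaler0 subr0.
- move=> i; rewrite leq_eqVlt => /orP[/eqP eki|lti].
    have -> : i = q by apply/val_inj.
    rewrite !mulmxBr -!scalemxAr aqU aqU' aU' a'U aW aW' bU' b'U !mulmx0 scaler0 subr0 sub0r.
    split; first by rewrite opprK.
    have bU : b q *m U = 0 by rewrite /U mulmxA (car_bb0 char2 ab) mul0mx.
    have b'U' : b' q *m U' = 0 by rewrite /U' mulmxA (car_bb0 char2 ab') mul0mx.
    have [_ _ _ bb'] := cc q q.
    rewrite bU b'U' scaler0 subr0 sub0r (comm_mulmx W (comm_mx_sym (b'G q))) GW.
    by rewrite -!scalemxAr (comm_mulmx _ bb') (comm_mulmx W (bG' q)).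
  have nqi : i != q by rewrite -val_eqE /= gtn_eqF.
  have [Gai Gbi] := hiG i lti; have [Gai' Gbi'] := hiG' i lti.
  have [hia hib] := hi i lti.
  have flip (x y z : 'M[F]_N) : anti x y -> anti z x ->
      x *m (y *m (z *m W)) = y *m (z *m (x *m W)).
    by move=> exy ezx; rewrite (anti_mulmx _ exy) (anti_mulmx _ (anti_sym ezx)) mulmxN opprK.
  have aiU : a i *m U = b q *m (G *m (a i *m W)) by apply: flip => //; apply: car_ab.
  have biU : b i *m U = b q *m (G *m (b i *m W)) by apply: flip => //; apply: car_bb.
  have aiU' : a' i *m U' = b' q *m (G' *m (a' i *m W)) by apply: flip => //; apply: car_ab.
  have biU' : b' i *m U' = b' q *m (G' *m (b' i *m W)) by apply: flip => //; apply: car_bb.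
  rewrite !mulmxBr -!scalemxAr aiU biU aiU' biU' aU' bU' a'U b'U hia hib.
  by rewrite !mulmxN !scalerN !opprK !opprB; split; rewrite addrC.
- move=> T c comT Tv; have [Ta Tb Ta' Tb'] := comT q.
  have TW := cT T c comT Tv.
  rewrite mulmxBr -scalemxAr commU //; last by apply: cG => j; have [] := comT j.
  rewrite commU' //; last by apply: cG' => j; have [] := comT j.
  by rewrite TW -!scalemxAr scalerBr !scalerA [s * c]mulrC.
Qed.

(** In S (x) S this is a singular vector of weight (1, ..., 1, 0, ..., 0), with k
ones: the modes before k are in the vacuum of both copies, and the others form an
invariant of the smaller orthogonal algebra. *)
Lemma fermion_pairing k : (k <= n)%N -> exists W : 'cV[F]_N,
  [/\ W != 0,
      forall i : 'I_n, (i < k)%N -> a i *m W = 0 /\ a' i *m W = 0,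
      forall i : 'I_n, (k <= i)%N ->
        a i *m W = - (a' i *m W) /\ b i *m W = - (b' i *m W) &
      forall T c, commutant T -> T *m v = c *: v -> T *m W = c *: W].
Proof.
move=> /subnKC /fermion_pairing_twist [W [_ [_ [_ [[W0 _ _ _] lo hi cT]]]]].
by exists W.
Qed.

(** The diagonal operators a_i + a'_i and b_j + b'_j kill W, hence so does their
bracket, in which the mixed terms vanish. *)
Lemma paired_bracket (W : 'cV[F]_N) i j :
  (a i *m W = - (a' i *m W)) -> (b j *m W = - (b' j *m W)) ->
  lie_bracket (a i) (b j) *m W + lie_bracket (a' i) (b' j) *m W = 0.
Proof.
move=> ea eb; have [_ ab'ij _ _] := cc i j; have [_ _ ba'ji _] := cc j i.
rewrite /lie_bracket !mulmxBl -!mulmxA ea eb !mulmxN.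
rewrite (comm_mulmx _ ab'ij) (comm_mulmx _ ba'ji) ea eb !mulmxN !opprK.
by rewrite [_ - _ *m _]addrC addrACA addNr subrr addr0.
Qed.

End Pairing.

End Fermions.

(** * Weights and singular vectors of tensor products *)

Section Kronecker.
Variable F : fieldType.

Lemma tensDl m n p q (A B : 'M[F]_(m, n)) (C : 'M[F]_(p, q)) :
  tensmx (A + B) C = tensmx A C + tensmx B C.
Proof. by apply/matrixP=> i j; rewrite !mxE mulrDl. Qed.

Lemma tensDr m n p q (A : 'M[F]_(m, n)) (B C : 'M[F]_(p, q)) :
  tensmx A (B + C) = tensmx A B + tensmx A C.
Proof. by apply/matrixP=> i j; rewrite !mxE mulrDr. Qed.

Lemma tensZl m n p q k (A : 'M[F]_(m, n)) (C : 'M[F]_(p, q)) :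
  tensmx (k *: A) C = k *: tensmx A C.
Proof. by apply/matrixP=> i j; rewrite !mxE mulrA. Qed.

Lemma tensZr m n p q k (A : 'M[F]_(m, n)) (C : 'M[F]_(p, q)) :
  tensmx A (k *: C) = k *: tensmx A C.
Proof. by apply/matrixP=> i j; rewrite !mxE mulrCA. Qed.

Lemma tens11 m p : tensmx (1%:M : 'M[F]_m) (1%:M : 'M[F]_p) = 1%:M.
Proof.
apply/matrixP=> i j; case: (mxtens_indexP i) => i1 i2; case: (mxtens_indexP j) => j1 j2.
rewrite tensmxE !mxE -natrM mulnb (can_eq (@mxtens_indexK m p)).
by congr (_%:R).
Qed.

(** The indices of the product have type 'I_(1 * 1); this fixes the type to that of
column vectors. *)
Definition tens_vec d e (u : 'cV[F]_d) (w : 'cV[F]_e) : 'cV[F]_(d * e) := tensmx u w.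

Lemma tens_vecE d e (u : 'cV[F]_d) (w : 'cV[F]_e) i j :
  tens_vec u w (mxtens_index (i, j)) 0 = u i 0 * w j 0.
Proof.
by rewrite -(tensmxE u w i j 0 0); congr (tensmx u w _ _); apply: val_inj.
Qed.

Lemma tens_vec_neq0 d e (u : 'cV[F]_d) (w : 'cV[F]_e) :
  u != 0 -> w != 0 -> tens_vec u w != 0.
Proof.
move=> /cV0Pn[i ui] /cV0Pn[j wj]; apply/cV0Pn; exists (mxtens_index (i, j)).
by rewrite tens_vecE mulf_neq0.
Qed.

Lemma tens_mul_vec d e (A : 'M[F]_d) (B : 'M[F]_e) u w :
  tensmx A B *m tens_vec u w = tens_vec (A *m u) (B *m w).
Proof. exact: (tensmx_mul A B u w). Qed.

Lemma tens_vecZl d e k (u : 'cV[F]_d) (w : 'cV[F]_e) :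
  tens_vec (k *: u) w = k *: tens_vec u w.
Proof. exact: (tensZl k u w). Qed.

Lemma tens_vecZr d e k (u : 'cV[F]_d) (w : 'cV[F]_e) :
  tens_vec u (k *: w) = k *: tens_vec u w.
Proof. exact: (tensZr k u w). Qed.

Lemma tens_vecDl d e (u u' : 'cV[F]_d) (w : 'cV[F]_e) :
  tens_vec (u + u') w = tens_vec u w + tens_vec u' w.
Proof. exact: (tensDl u u' w). Qed.

Lemma tens_vecDr d e (u : 'cV[F]_d) (w w' : 'cV[F]_e) :
  tens_vec u (w + w') = tens_vec u w + tens_vec u w'.
Proof. exact: (tensDr u w w'). Qed.

Lemma tens_vec0l d e (w : 'cV[F]_e) : tens_vec (0 : 'cV[F]_d) w = 0.
Proof. exact: (@tens0mx F d 1 e 1 w). Qed.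

Lemma tens_vec0r d e (u : 'cV[F]_d) : tens_vec u (0 : 'cV[F]_e) = 0.
Proof. exact: (@tensmx0 F d 1 e 1 u). Qed.

Lemma tens_vec_span d e (v : 'cV[F]_(d * e)) :
  v = \sum_i \sum_j v (mxtens_index (i, j)) 0 *: tens_vec (delta_mx i 0) (delta_mx j 0).
Proof.
apply/colP => k; case: (mxtens_indexP k) => i j.
rewrite summxE (bigD1 i) //= summxE (bigD1 j) //= mxE tens_vecE !mxE !eqxx !mulr1.
rewrite big1 ?addr0 => [|l nl]; last first.
  by rewrite mxE tens_vecE !mxE [j == l]eq_sym (negPf nl) !mulr0.
rewrite big1 ?addr0 // => l nl; rewrite summxE big1 // => l' _.
by rewrite mxE tens_vecE !mxE [i == l]eq_sym (negPf nl) mul0r mulr0.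
Qed.

End Kronecker.

Section TensorProducts.
Variables (F : fieldType) (n : nat).
Hypothesis F_char0 : [pchar F] =i pred0.

Lemma weight_sum_ind (M : so_module F n) s (P : 'cV[F]_(mdim M) -> Prop) v :
  P 0 -> (forall u w, P u -> P w -> P (u + w)) ->
  (forall la u, la \in s -> u \in weight_space M la -> P u) ->
  v \in (\sum_(mu <- s) weight_space M mu)%VS -> P v.
Proof.
move=> P0 PD; elim: s v => [|la s IH] v Pw; first by rewrite big_nil memv0 => /eqP ->.
rewrite big_cons => /memv_addP[u uw [w ws ->]]; apply: PD.
  by apply: Pw uw; rewrite mem_head.
by apply: IH ws => mu x ms; apply: Pw; rewrite inE ms orbT.
Qed.

Lemma weight_sum_mem (M : so_module F n) s la (v : 'cV[F]_(mdim M)) :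
  la \in s -> v \in weight_space M la -> v \in (\sum_(mu <- s) weight_space M mu)%VS.
Proof.
elim: s => // mu s IH; rewrite inE big_cons => /orP[/eqP ->|ls] vw.
  by apply: (subvP (addvSl _ _)).
by apply: (subvP (addvSr _ _)); apply: IH.
Qed.

Lemma weights_spanP (M : so_module F n) s :
  weights_span M s <-> forall v, v \in (\sum_(mu <- s) weight_space M mu)%VS.
Proof.
split=> [e v|h]; first by rewrite e memvf.
by apply/eqP; rewrite eqEsubv subvf; apply/subvP => v _; apply: h.
Qed.

Lemma tensor_mact_vec (M N : so_module F n) A u w :
  mact (tensor_module M N) A *m tens_vec u w =
  tens_vec (mact M A *m u) w + tens_vec u (mact N A *m w).
Proof.
rewrite -[mact (tensor_module M N) A]/(tensor_act M N A) mulmxDl.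
by rewrite !tens_mul_vec !mul1mx.
Qed.

Lemma tensor_weight (M N : so_module F n) la mu u w :
  u \in weight_space M la -> w \in weight_space N mu ->
  tens_vec u w \in weight_space (tensor_module M N) (la + mu).
Proof.
move=> /weight_spaceP hu /weight_spaceP hw; apply/weight_spaceP => i.
rewrite tensor_mact_vec -/(opH M i) -/(opH N i) hu hw tens_vecZl tens_vecZr -scalerDl.
by rewrite mxE ratr_additive.
Qed.

Lemma tensor_weights_span (M N : so_module F n) s t :
  weights_span M s -> weights_span N t ->
  weights_span (tensor_module M N) [seq la + mu | la <- s, mu <- t].
Proof.
move=> /weights_spanP sM /weights_spanP sN; apply/weights_spanP => v.
pose st := [seq la + mu | la <- s, mu <- t].
pose V := (\sum_(nu <- st) weight_space (tensor_module M N) nu)%VS.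
suff cl u w : tens_vec u w \in V.
  by rewrite [v]tens_vec_span rpred_sum // => i _; rewrite rpred_sum // => j _; rewrite rpredZ.
apply: (weight_sum_ind (P := fun u => tens_vec u w \in V) _ _ _ (sM u)).
- by rewrite tens_vec0l mem0v.
- by move=> x y hx hy; rewrite tens_vecDl; apply: rpredD.
move=> la {}u ls uw.
apply: (weight_sum_ind (P := fun w => tens_vec u w \in V) _ _ _ (sN w)).
- by rewrite tens_vec0r mem0v.
- by move=> x y hx hy; rewrite tens_vecDr; apply: rpredD.
move=> mu {}w mt ww; apply: (weight_sum_mem (la := la + mu)); last exact: tensor_weight.
by apply/allpairsP; exists (la, mu).
Qed.

Lemma tensor_highest_weight (M N : so_module F n) la mu :
  has_highest_weight M la -> has_highest_weight N mu ->
  has_highest_weight (tensor_module M N) (la + mu).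
Proof.
move=> [u [_ u0 uwt uhw]] [w [_ w0 wwt whw]]; exists (tens_vec u w); split.
- exact: memvf.
- by rewrite memv0 tens_vec_neq0 // -memv0.
- move=> i; rewrite memv0 tensor_mact_vec subr_eq0 mxE ratr_additive //.
  move: (uwt i) (wwt i); rewrite !memv0 !subr_eq0 => /eqP -> /eqP ->.
  by rewrite tens_vecZl tens_vecZr scalerDl.
move=> i A rA; move: (uhw i A rA) (whw i A rA); rewrite !memv0 tensor_mact_vec.
by move=> /eqP -> /eqP ->; rewrite tens_vec0l tens_vec0r addr0.
Qed.

(** The simple root vectors X_n and [X_i, Y_(i+1)] suffice. *)
Lemma singular_criterion (M : so_module F n) (la : 'rV[rat]_n) (v : 'cV[F]_(mdim M)) : v != 0 ->
  (forall i, opH M i *m v = ratr (la 0 i) *: v) ->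
  (forall i : 'I_n, i.+1 = n -> opX M i *m v = 0) ->
  (forall i i' : 'I_n, i.+1 = i' -> lie_bracket (opX M i) (opY M i') *m v = 0) ->
  has_highest_weight M la.
Proof.
move=> v0 Hv Xv XYv; exists v; split; first exact: memvf.
- by rewrite memv0.
- by move=> i; rewrite -/(opH M i) Hv subrr mem0v.
move=> i A rA; rewrite memv0; apply/eqP.
have lin k B C : B \in so F n -> C \in so F n -> mact M B *m v = 0 ->
    mact M C *m v = 0 -> mact M (k *: B + C) *m v = 0.
  by move=> sB sC eB eC; rewrite mact_linear // mulmxDl -scalemxAl eB eC scaler0 addr0.
have zero : mact M 0 *m v = 0 by rewrite mact0 mul0mx.
have [e|lt] : i.+1 = n \/ (i.+1 < n)%N by have := ltn_ord i; lia.
  by apply: (last_root_space (P := fun B => mact M B *m v = 0) F_char0 zero lin e rA); apply: Xv.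
apply: (next_root_space (P := fun B => mact M B *m v = 0) (i' := Ordinal lt) F_char0 zero lin _ rA) => //.
by rewrite mact_bracket ?short_so //; apply: XYv.
Qed.

Lemma singular_vector (M : so_module F n) la : has_highest_weight M la ->
  exists v : 'cV[F]_(mdim M), [/\ v != 0, forall i, opH M i *m v = ratr (la 0 i) *: v,
    forall i : 'I_n, opX M i *m v = 0 &
    forall i i' : 'I_n, i.+1 = i' -> lie_bracket (opX M i) (opY M i') *m v = 0].
Proof.
move=> [v [_ v0 wt hw]]; exists v.
have Xv_last (i : 'I_n) : i.+1 = n -> opX M i *m v = 0.
  by move=> e; apply/eqP; rewrite -memv0; apply: (hw i); apply: short_in_root_space.
have XYv (i i' : 'I_n) : i.+1 = i' -> lie_bracket (opX M i) (opY M i') *m v = 0.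
  move=> e; rewrite -mact_bracket ?short_so //; apply/eqP; rewrite -memv0.
  by apply: (hw i); apply: long_in_root_space.
split=> //; first by rewrite -memv0.
- by move=> i; apply/eqP; have := wt i; rewrite memv0 subr_eq0.
- exact: Xv Xv_last XYv.
Qed.

End TensorProducts.

(** * Tensor powers of the spin module *)

Section SpinTensor.
Variables (F : fieldType) (n : nat).
Hypothesis F_char0 : [pchar F] =i pred0.
Variable S : so_module F n.
Hypothesis S_irr : irreducible S.
Hypothesis S_spin : has_highest_weight S (spin_weight n).

Let b (i : 'I_n) := - 2%:R *: opY S i.
Let S_car : car (opX S) b := spin_car F_char0 S_irr S_spin.
Let char2 : 2%:R != 0 :> F := two_neq0 F_char0.

Lemma spin_parity i : opH S i = 2%:R^-1 *: parity (opX S) b i.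
Proof.
rewrite /parity -/(lie_bracket _ _) bracketZr bracket_XY scaleNr !scalerN opprK.
by rewrite scalerA mulVf // scale1r.
Qed.

Lemma car_morph D N (f : 'M[F]_D -> 'M[F]_N) (x y : 'I_n -> 'M[F]_D) :
  {morph f : A B / A + B} -> {morph f : A B / A *m B} -> f 1%:M = 1%:M ->
  car x y -> car (fun i => f (x i)) (fun i => f (y i)).
Proof.
move=> fD fM f1 xy i j; have [exx eyy exy] := xy i j.
have f0 : f 0 = 0 by apply: (addrI (f 0)); rewrite -fD !addr0.
rewrite -!fM -!fD exx eyy exy f0; split=> //.
by case: (i == j); rewrite ?f1 // !raddf0.
Qed.

Section Step.
Variable T : so_module F n.
Variable mu : 'rV[rat]_n.
Hypothesis T_mu : has_highest_weight T mu.

Let D := mdim S.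
Let E := mdim T.
Let N := (D * (D * E))%N.
Let M2 := tensor_module S (tensor_module S T).
(** The actions on the factors of S (x) (S (x) T). *)
Definition act1 A : 'M[F]_N := tensmx A 1%:M.
Definition act2 A : 'M[F]_N := tensmx 1%:M (tensmx A 1%:M).
Definition act3 B : 'M[F]_N := tensmx 1%:M (tensmx 1%:M B).

Lemma mact_M2 A : mact M2 A = act1 (mact S A) + act2 (mact S A) + act3 (mact T A).
Proof. by rewrite -addrA -tensDr. Qed.

Lemma act1_car : car (fun i => act1 (opX S i)) (fun i => act1 (b i)).
Proof.
apply: car_morph S_car => [A B|A B|]; first exact: tensDl.
- by rewrite /act1 tensmx_mul mulmx1.
- exact: tens11.
Qed.

Lemma act2_car : car (fun i => act2 (opX S i)) (fun i => act2 (b i)).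
Proof.
apply: car_morph S_car => [A B|A B|]; first by rewrite /act2 tensDl tensDr.
- by rewrite /act2 !tensmx_mul !mulmx1.
- by rewrite /act2 !tens11.
Qed.

Lemma act1_act2 A B : comm_mx (act1 A) (act2 B).
Proof. by rewrite /comm_mx /act1 /act2 !tensmx_mul !mulmx1 !mul1mx. Qed.

Lemma act1_act3 A B : comm_mx (act1 A) (act3 B).
Proof. by rewrite /comm_mx /act1 /act3 !tensmx_mul !mulmx1 !mul1mx. Qed.

Lemma act2_act3 A B : comm_mx (act2 A) (act3 B).
Proof. by rewrite /comm_mx /act2 /act3 !tensmx_mul !mulmx1 !mul1mx. Qed.

Lemma act1E A (v w : 'cV[F]_D) (t : 'cV[F]_E) :
  act1 A *m tens_vec v (tens_vec w t) = tens_vec (A *m v) (tens_vec w t).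
Proof. by rewrite /act1 tens_mul_vec mul1mx. Qed.

Lemma act2E A (v w : 'cV[F]_D) (t : 'cV[F]_E) :
  act2 A *m tens_vec v (tens_vec w t) = tens_vec v (tens_vec (A *m w) t).
Proof. by rewrite /act2 !tens_mul_vec !mul1mx. Qed.

Lemma act3E A (v w : 'cV[F]_D) (t : 'cV[F]_E) :
  act3 A *m tens_vec v (tens_vec w t) = tens_vec v (tens_vec w (A *m t)).
Proof. by rewrite /act3 !tens_mul_vec !mul1mx. Qed.

Lemma act1Z k A : act1 (k *: A) = k *: act1 A. Proof. exact: tensZl. Qed.
Lemma act2Z k A : act2 (k *: A) = k *: act2 A.
Proof. by rewrite /act2 tensZl tensZr. Qed.

Lemma act1_bracket A B : act1 (lie_bracket A B) = lie_bracket (act1 A) (act1 B).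
Proof.
by rewrite /lie_bracket -scaleN1r [act1 _]tensDl tensZl scaleN1r /act1 !tensmx_mul !mulmx1.
Qed.

Lemma act2_bracket A B : act2 (lie_bracket A B) = lie_bracket (act2 A) (act2 B).
Proof.
rewrite /lie_bracket -scaleN1r /act2 tensDl tensDr tensZl tensZr scaleN1r.
by rewrite !tensmx_mul !mulmx1.
Qed.

(** Apply [fermion_pairing] to the highest weight vector of S (x) (S (x) T). The
operators on T commute with the fermions, so the weight on T and the vanishing of
its positive root vectors are kept. *)
Lemma spin_square_step k : (k <= n)%N ->
  has_highest_weight M2 (mu + \row_i ((i < k)%N)%:R).
Proof.
move=> le_kn.
have [v [v0 Hv Xv XYv]] := singular_vector S_spin.
have [t [t0 Ht Xt XYt]] := singular_vector T_mu.
pose vvt := tens_vec v (tens_vec v t) : 'cV[F]_N.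
have vvt0 : vvt != 0 by rewrite !tens_vec_neq0.
pose a1 i := act1 (opX S i); pose b1 i := act1 (b i).
pose a2 i := act2 (opX S i); pose b2 i := act2 (b i).
have cc i j : [/\ comm_mx (a1 i) (a2 j), comm_mx (a1 i) (b2 j),
  comm_mx (b1 i) (a2 j) & comm_mx (b1 i) (b2 j)] by split; apply: act1_act2.
have av1 i : a1 i *m vvt = 0 by rewrite act1E Xv tens_vec0l.
have av2 i : a2 i *m vvt = 0 by rewrite act2E Xv tens_vec0l tens_vec0r.
have [W [W0 lo hi cT]] := fermion_pairing char2 act1_car act2_car cc vvt0 av1 av2 le_kn.
have act3W B c : B *m t = c *: t -> act3 B *m W = c *: W.
  move=> Bt; apply: cT; last by rewrite act3E Bt !tens_vecZr.
  by move=> i; split; apply: comm_mx_sym; (apply: act1_act3 || apply: act2_act3).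
apply: (singular_criterion (M := M2) F_char0 W0) => [i|i e|i i' e].
- have -> : opH M2 i = act1 (opH S i) + act2 (opH S i) + act3 (opH T i) by apply: mact_M2.
  rewrite mulmxDl (act3W _ _ (Ht i)) mxE ratr_additive // scalerDl addrC; congr (_ + _).
  rewrite !mxE ratr_nat spin_parity act1Z act2Z -scalerDr -scalemxAl mulmxDl.
  rewrite /parity -!/(lie_bracket _ _) act1_bracket act2_bracket.
  have [lt|ge] := ltnP i k.
    have [aW aW'] := lo i lt.
    have := parity_kill act1_car aW; rewrite /parity -/(lie_bracket _ _) => ->.
    have := parity_kill act2_car aW'; rewrite /parity -/(lie_bracket _ _) => ->.
    by rewrite -mulr2n -scaler_nat scalerA mulVf.
  have [aW bW] := hi i ge.
  by rewrite (paired_bracket cc aW bW) scaler0 scale0r.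
- have -> : opX M2 i = act1 (opX S i) + act2 (opX S i) + act3 (opX T i) by apply: mact_M2.
  rewrite !mulmxDl (act3W _ 0) ?Xt ?scale0r // addr0.
  have [/lo[aW aW']|/hi[aW _]] := ltnP i k; first by rewrite aW aW' addr0.
  by rewrite aW addNr.
rewrite -mact_bracket ?short_so // mact_M2 !mulmxDl (act3W _ 0); last first.
  by rewrite scale0r mact_bracket ?short_so //; apply: XYt.
rewrite scale0r addr0 mact_bracket ?short_so // -/(opX S i) -/(opY S i').
have -> : opY S i' = (- 2%:R^-1) *: b i'.
  by rewrite scalerA mulrNN mulVf // scale1r.
rewrite bracketZr act1Z act2Z -mulmxDl -scalerDr -scalemxAl act1_bracket act2_bracket mulmxDl.
suff -> : lie_bracket (a1 i) (b1 i') *m W + lie_bracket (a2 i) (b2 i') *m W = 0.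
  by rewrite scaler0.
have [lt|ge] := ltnP i k.
  have nii : i != i' by rewrite -val_eqE /= -e; lia.
  have [aW aW'] := lo i lt.
  rewrite /lie_bracket !mulmxBl -!mulmxA.
  rewrite (anti_mulmx _ (car_ab act1_car nii)) (anti_mulmx _ (car_ab act2_car nii)).
  by rewrite aW aW' !mulmx0 !oppr0 !addr0.
have [aW _] := hi i ge; have [_ bW] := hi i' (leq_trans ge (ltnW (eq_leq e))).
exact: (paired_bracket cc aW bW).
Qed.

End Step.

(** Since H_i ^ 2 = 1/4, every vector splits into eigenvectors of the H_i. *)
Definition half_signs (f : {ffun 'I_n -> bool}) : 'rV[rat]_n :=
  \row_i (if f i then 2%:R^-1 else - 2%:R^-1).

Lemma spin_H_sq i (w : 'cV[F]_(mdim S)) : opH S i *m (opH S i *m w) = (2%:R^-1 * 2%:R^-1) *: w.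
Proof.
by rewrite mulmxA !spin_parity -scalemxAl -scalemxAr scalerA parity_sq // -scalemxAl mul1mx.
Qed.

Lemma ratr_half1 : ratr 2%:R^-1 = 2%:R^-1 :> F.
Proof. by have := ratr_half F_char0 1; rewrite !mul1r. Qed.

Lemma spin_weights_span : weights_span S [seq half_signs f | f <- enum {ffun 'I_n -> bool}].
Proof.
apply/weights_spanP; set V := (\sum_(_ <- _) _)%VS.
(* Split with respect to H_k, H_(k+1), ... in turn. *)
suff ind m k (v : 'cV[F]_(mdim S)) : (k + m)%N = n -> (forall i : 'I_n, (i < k)%N ->
    opH S i *m v = 2%:R^-1 *: v \/ opH S i *m v = - 2%:R^-1 *: v) -> v \in V.
  by move=> v; apply: (ind n 0%N).
elim: m k v => [|m IH] k v.
  rewrite addn0 => -> hv.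
  pose f := [ffun i => opH S i *m v == 2%:R^-1 *: v].
  apply: (weight_sum_mem (la := half_signs f)); first by rewrite map_f // mem_enum.
  apply/weight_spaceP => i; rewrite mxE ffunE.
  case: eqP => [-> //|ne]; rewrite ?ratrN // ratr_half1 //.
  by have [|//] := hv i (ltn_ord i).
rewrite addnS -addSn => e hv; have lt : (k < n)%N by move: e; lia.
pose q := Ordinal lt.
have split_v : v = (2%:R^-1 *: v + opH S q *m v) + (2%:R^-1 *: v - opH S q *m v).
  by rewrite addrACA subrr addr0 -scalerDl -mulr2n -(mulr_natl 2%:R^-1) mulfV // scale1r.
have eig (c d : F) i : opH S i *m v = d *: v ->
    opH S i *m (2%:R^-1 *: v + c *: (opH S q *m v)) = d *: (2%:R^-1 *: v + c *: (opH S q *m v)).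
  move=> ev; rewrite mulmxDr -!scalemxAr cartan_act_comm ev -scalemxAr scalerDr.
  by rewrite !scalerA [c * d]mulrC [_ * d]mulrC.
have part (c : F) : c = 1 \/ c = - 1 -> 2%:R^-1 *: v + c *: (opH S q *m v) \in V.
  move=> c1; apply: (IH _ _ e) => i; rewrite ltnS leq_eqVlt => /orP[/eqP ei|lti].
    have -> : i = q by apply/val_inj.
    rewrite mulmxDr -!scalemxAr spin_H_sq scalerA.
    case: c1 => ->; [left | right].
      by rewrite !scale1r mul1r scalerDr scalerA addrC.
    by rewrite !scaleN1r mulN1r !scaleNr scalerDr scalerN scalerA opprD opprK addrC.
  by case: (hv i lti) => /(eig c); [left | right].
rewrite split_v rpredD //.
  by have := part 1 (or_introl erefl); rewrite scale1r.
by have := part (- 1) (or_intror erefl); rewrite scaleN1r.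
Qed.

(** The weights of the r-th tensor power lie in the cube of side r centred at 0. *)
Definition cube_weight r (la : 'rV[rat]_n) : Prop :=
  forall i, exists2 k : nat, (k <= r)%N & la 0 i = k%:R - r%:R / 2%:R.

Lemma tensor_power_weights r : exists s, weights_span (tensor_power S r) s /\
  forall la, la \in s -> cube_weight r la.
Proof.
elim: r => [|r [s [sp cube]]].
  exists [:: 0]; split; last first.
    by move=> la; rewrite inE => /eqP -> i; exists 0%N; rewrite // mxE mul0r subr0.
  apply/weights_spanP => v; apply: (weight_sum_mem (la := 0)); first by rewrite inE.
  apply/weight_spaceP => i.
  by rewrite mxE ratr0 scale0r -[opH _ i]/(0 : 'M_1) mul0mx.
exists [seq la + mu | la <- [seq half_signs f | f <- enum {ffun 'I_n -> bool}], mu <- s].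
split; first exact: (tensor_weights_span F_char0 spin_weights_span sp).
move=> _ /allpairsP[[_ mu] /= [/mapP[f _ ->] /cube h ->]] i; have [k lek e] := h i.
exists (k + f i)%N; first by case: (f i); rewrite ?addn1 ?addn0 ?ltnS // ltnW.
by rewrite !mxE e -[r.+1]addn1 !natrD; case: (f i) => /=; field.
Qed.

Lemma trivial_highest_weight : has_highest_weight (trivial_module F n) 0.
Proof.
apply: (@singular_criterion F n F_char0 (trivial_module F n) 0 (1%:M : 'M_1)).
- exact: matrix_nonzero1.
- by move=> i; rewrite mxE ratr0 scale0r -[opH _ i]/(0 : 'M_1) mul0mx.
- by move=> i _; rewrite -[opX _ i]/(0 : 'M_1) mul0mx.
by move=> i i' _; rewrite -[opX _ i]/(0 : 'M_1) -[opY _ i']/(0 : 'M_1) /lie_bracket !mul0mx subrr mul0mx.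
Qed.

(** The weight is l / 2. Two factors S contribute 1 to each entry of the weight that is
at least 1, and the rest is a weight of the same kind for r - 2; the smaller entries
are 0, or all 1/2 when r is odd. *)
Lemma tensor_power_singular r (l : 'I_n -> nat) :
  (forall i j : 'I_n, (i <= j)%N -> (l j <= l i)%N) ->
  (forall i, (l i <= r)%N /\ odd (l i) = odd r) ->
  has_highest_weight (tensor_power S r) (\row_i ((l i)%:R / 2%:R)).
Proof.
have [m] := ubnP r; elim: m r l => // m IH [|[|r]] l ltm mono bound.
- have -> : \row_i ((l i)%:R / 2%:R) = 0 :> 'rV[rat]_n.
    apply/rowP => i; rewrite !mxE; have [le0 _] := bound i.
    by move: le0; rewrite leqn0 => /eqP ->; rewrite mul0r.
  exact: trivial_highest_weight.
- have -> : \row_i ((l i)%:R / 2%:R) = spin_weight n + 0 :> 'rV[rat]_n.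
    apply/rowP => i; rewrite addr0 spin_weightE mxE; have [le1 od] := bound i.
    have -> : l i = 1%N by move: le1 od; case: (l i) => [|[|]].
    by rewrite mul1r.
  exact: (tensor_highest_weight F_char0 S_spin trivial_highest_weight).
(* The entries at least 2 of l, that is at least 1 of the weight, are the first k. *)
pose P k := [forall i : 'I_n, (k <= i)%N ==> (l i < 2)%N].
have exP : exists k, P k.
  by exists n; apply/forallP => i; rewrite leqNgt ltn_ord.
case: (ex_minnP exP) => k /forallP Pk mink.
have le_kn : (k <= n)%N by apply: mink; apply/forallP => i; rewrite leqNgt ltn_ord.
have kl (i : 'I_n) : (i < k)%N = (2 <= l i)%N.
  apply/idP/idP => [lt|ge]; last first.
    by rewrite ltnNge; apply/negP => le; have := Pk i; rewrite le /= ltnNge ge.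
  rewrite leqNgt; apply/negP => l2; have /mink : P i; last by rewrite leqNgt lt.
  by apply/forallP => j; apply/implyP => /mono; move: l2; lia.
pose l' i := if (2 <= l i)%N then (l i - 2)%N else l i.
have hw' : has_highest_weight (tensor_power S r) (\row_i ((l' i)%:R / 2%:R)).
  apply: IH => [|i j le|i].
  - by move: ltm; lia.
  - have [_ oi] := bound i; have [_ oj] := bound j; have := mono i j le.
    have := odd_double_half (l i); have := odd_double_half (l j).
    by rewrite oi oj /l'; case: ifP; case: ifP; lia.
  - have [bi oi] := bound i; rewrite /= negbK in oi; rewrite /l'; case: ifP => le2.
      by rewrite oddB // oi addbF; split=> //; move: bi; lia.
    split=> //; have := odd_double_half (l i); have := odd_double_half r.
    by rewrite oi; move: le2; lia.
have := spin_square_step hw' le_kn; congr has_highest_weight.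
apply/rowP => i; rewrite !mxE kl /l'; case: ifP => le2; last by rewrite addr0.
by rewrite natrB // mulr1n; field.
Qed.

End SpinTensor.

(** * Dominant weights in the cube, and saturation *)

Section DominantWeights.
Variable n : nat.
Implicit Types (la : 'rV[rat]_n) (i j : 'I_n).

Lemma cube_weight_lattice r la : cube_weight r la -> in_weight_lattice la.
Proof.
move=> cube; have er : r%:R / 2%:R = (r./2)%:R + (odd r)%:R / 2%:R :> rat.
  by rewrite -{1}[r]odd_double_half natrD -mul2n natrM; field.
case: (boolP (odd r)) => odr; rewrite ?odr ?(negPf odr) in er; [right|left] => i;
  have [k _ ->] := cube i; rewrite er.
  have -> : k%:R - ((r./2)%:R + true%:R / 2%:R) - 2%:R^-1 = k%:R - (r./2)%:R - 1 :> rat.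
    by rewrite mulr1n; field.
  by rewrite !rpredB ?Num.Theory.natr_int ?rpred1.
by rewrite mul0r addr0 rpredB ?Num.Theory.natr_int.
Qed.

Lemma dominant_coordinates la : dominant la ->
  (forall i, 0 <= la 0 i) /\ (forall i j, (i <= j)%N -> la 0 j <= la 0 i).
Proof.
move=> [_ dom].
have next (i i' : 'I_n) : i.+1 = i' -> la 0 i' <= la 0 i.
  by move=> e; have := dom i; rewrite (pairing_next _ e) Num.Theory.subr_ge0.
split.
  move=> i; have [m] : exists m, (n <= i + m)%N by exists n; rewrite leq_addl.
  elim: m i => [|m IH] i le; first by have := ltn_ord i; lia.
  have [e|lt] : i.+1 = n \/ (i.+1 < n)%N by have := ltn_ord i; lia.
    by have := dom i; rewrite (pairing_last _ e) Num.Theory.pmulr_rge0.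
  by apply: Order.POrderTheory.le_trans (next i (Ordinal lt) erefl); apply: IH => /=; lia.
move=> i j; have [m] : exists m, (j <= i + m)%N by exists j; rewrite leq_addl.
elim: m i => [|m IH] i le1 le2.
  by have -> : i = j by apply/val_inj => /=; lia.
have [e|lt] : i = j :> nat \/ (i < j)%N by lia.
  by have -> : i = j by apply/val_inj.
have ltn : (i.+1 < n)%N by apply: leq_ltn_trans lt _.
by apply: Order.POrderTheory.le_trans (next i (Ordinal ltn) erefl); apply: IH => /=; lia.
Qed.

(** The numerators k of [cube_weight] are recentred: l = 2 k - r. *)
Lemma cube_weight_nat r la : cube_weight r la -> (forall i, 0 <= la 0 i) ->
  exists l : 'I_n -> nat, (forall i, la 0 i = (l i)%:R / 2%:R) /\
    (forall i, (l i <= r)%N /\ odd (l i) = odd r).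
Proof.
move=> cube ge0.
have h i : exists l : nat, [&& la 0 i == l%:R / 2%:R, (l <= r)%N & odd l == odd r].
  have [k lek e] := cube i; exists (k.*2 - r)%N.
  have ge : (r <= k.*2)%N.
    have := ge0 i; rewrite e Num.Theory.subr_ge0 Num.Theory.ler_pdivrMr //.
    by rewrite -natrM Num.Theory.ler_nat muln2.
  rewrite e natrB // -mul2n natrM oddB ?mul2n // odd_double /= eqxx andbT.
  by apply/andP; split; [apply/eqP; field | move: lek; lia].
exists (fun i => xchoose (h i)); split=> i; have /and3P[/eqP e le /eqP od] := xchooseP (h i).
  exact: e.
by split.
Qed.

End DominantWeights.

Theorem theoremA7 (F : fieldType) (n : nat) (F_char0 : [pchar F] =i pred0)
    (n_gt0 : (0 < n)%N) (S : so_module F n) (S_irr : irreducible S)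
    (S_spin : has_highest_weight S (spin_weight n)) (r : nat) :
  saturated (tensor_power S r).
Proof.
have [s [sp cube]] := tensor_power_weights F_char0 S_irr S_spin r.
split.
  exists (undup s); split; first exact: undup_uniq.
    by move=> la; rewrite mem_undup => /cube; apply: cube_weight_lattice.
  apply/weights_spanP => v; move/weights_spanP: sp => /(_ v).
  apply: (weight_sum_ind (P := fun v => v \in _)); first exact: mem0v.
    by move=> u w; apply: rpredD.
  by move=> la u ls; apply: weight_sum_mem; rewrite mem_undup.
move=> la; split.
  move=> [t [k [[_ _ _ ct] lt hw]]]; have [sU sW _ _ _] := ct k lt.
  have [w0 las] := quotient_weight F_char0 sp sW hw.
  split=> //; split; first exact: cube_weight_lattice (cube la las).
  by move=> i; apply: (quotient_weight_pairing F_char0 i sW hw).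
move=> [dom w0]; apply: highest_weight_factor.
have /cube cla := weight_in_span F_char0 sp w0.
have [ge0 mono] := dominant_coordinates dom.
have [l [el bound]] := cube_weight_nat cla ge0.
have -> : la = \row_i ((l i)%:R / 2%:R) by apply/rowP => i; rewrite mxE el.
apply: tensor_power_singular => // i j /mono; rewrite !el.
by rewrite Num.Theory.ler_pM2r ?Num.Theory.invr_gt0 // Num.Theory.ler_nat.
Qed.
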